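(* The plethysm coefficients are not, in general, positive combinations of counting functions of lattice points in integral scalings of convex bodies. Precisely: there exist positive integers $d,k$ and a partition $\lambda$ of $dk$ such that the function $s\mapsto m^{d,sk}_{s\lambda}$ on $\mathbb{Z}_{\ge 0}$ cannot be written in the form $$s\mapsto\sum_{i=1}^{N} c_i\,\#\bigl(sC_i\cap\mathbb{Z}^{m_i}\bigr)$$ with $N$ a nonnegative integer, positive real numbers $c_1,\dots,c_N$ and compact convex sets $C_i\subset\mathbb{R}^{m_i}$; and likewise there exist positive integers $d,k$ and a partition $\lambda$ of $dk$ such that the function $s\mapsto m^{sd,k}_{s\lambda}$ on $\mathbb{Z}_{\ge 0}$ cannot be written in this form.
   Context: Plethysm coefficients: for integers $d,k\ge 0$ and a partition $\lambda$ of $dk$, the coefficient $m^{d,k}_\lambda$ is defined by the decomposition $$S^d(S^kW)=\bigoplus_{\lambda} m^{d,k}_\lambda\, S^\lambda W$$ into irreducible $GL(W)$-representations, the sum being over partitions $\lambda$ of $dk$. Here $W$ is a finite-dimensional complex vector space of sufficiently large dimension (the coefficient of $S^\lambda W$ does not depend on $\dim W$ as long as $\dim W$ is at least the number of nonzero parts of $\lambda$), $S^k$ denotes the symmetric power and $S^\lambda$ the Schur functor (irreducible representation) associated with $\lambda$. For a partition $\lambda=(\lambda_1,\dots,\lambda_l)$ and an integer $s\ge 0$, $s\lambda=(s\lambda_1,\dots,s\lambda_l)$. For a set $C\subset\mathbb{R}^m$ and an integer $s\ge 0$, $sC=\{sx:x\in C\}$. *)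

(* Defs.v *)
From HB Require Import structures.
From mathcomp Require Import all_boot all_order all_algebra all_fingroup.
From mathcomp Require Import finmap complex.
From mathcomp Require Import all_classical all_reals all_analysis.

Set Implicit Arguments.
Unset Strict Implicit.
Unset Printing Implicit Defensive.

Import Order.TTheory GRing.Theory Num.Theory.
Import numFieldNormedType.Exports.

Local Open Scope classical_set_scope.
Local Open Scope ring_scope.

Section TensorPowers.
Variable F : fieldType.

(* The vector space F^I with its standard basis indexed by I. *)
Notation vec I := {ffun I -> F^o}.

Definition std_basis (I : finType) (i : I) : vec I :=
  [ffun j => (j == i)%:R : F^o].

(* The k-th tensor power of F^I is F^(I^k): the multi-index f stands for
   e_(f 0) (x) ... (x) e_(f (k-1)). *)
Notation tensor k I := {ffun {ffun 'I_k -> I} -> F^o}.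

Definition pure_tensor (k : nat) (I : finType) (u : 'I_k -> vec I) :
    tensor k I :=
  [ffun f : {ffun 'I_k -> I} => (\prod_a u a (f a)) : F^o].

(* U (x) ... (x) U, as a subspace of the k-th tensor power of F^I. *)
Definition tensor_power (k : nat) (I : finType) (U : {vspace vec I}) :
    {vspace tensor k I} :=
  <<[seq pure_tensor (fun a => (vbasis U)`_(f a))
    | f : {ffun 'I_k -> 'I_(\dim U)}]>>%VS.

(* A (x) ... (x) A *)
Definition tensor_map_fun (k : nat) (I : finType) (A : 'End(vec I))
    (t : tensor k I) : tensor k I :=
  \sum_(f : {ffun 'I_k -> I})
    (t f : F) *: pure_tensor (fun a => A (std_basis (f a))).

Fact tensor_map_fun_is_linear (k : nat) (I : finType) (A : 'End(vec I)) :
  linear (@tensor_map_fun k I A).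
Proof.
move=> c t u; rewrite /tensor_map_fun scaler_sumr -big_split /=.
by apply: eq_bigr => f _; rewrite !ffunE scalerDl scalerA.
Qed.

HB.instance Definition _ (k : nat) (I : finType) (A : 'End(vec I)) :=
  GRing.isLinear.Build F (tensor k I) (tensor k I) _ (@tensor_map_fun k I A)
    (@tensor_map_fun_is_linear k I A).

Definition tensor_map (k : nat) (I : finType) (A : 'End(vec I)) : 'End(tensor k I) :=
  linfun (@tensor_map_fun k I A).

Definition permute_factors_fun (k : nat) (I : finType) (s : 'S_k)
    (t : tensor k I) : tensor k I :=
  [ffun f : {ffun 'I_k -> I} => t [ffun a => f (s a)]].

Fact permute_factors_fun_is_linear (k : nat) (I : finType) (s : 'S_k) :
  linear (@permute_factors_fun k I s).
Proof. by move=> c t u; apply/ffunP => f; rewrite !ffunE. Qed.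

HB.instance Definition _ (k : nat) (I : finType) (s : 'S_k) :=
  GRing.isLinear.Build F (tensor k I) (tensor k I) _ (@permute_factors_fun k I s)
    (@permute_factors_fun_is_linear k I s).

Definition permute_factors (k : nat) (I : finType) (s : 'S_k) : 'End(tensor k I) :=
  linfun (@permute_factors_fun k I s).

(* The k-th symmetric power of U, realised (F being of characteristic 0) as the
   space of symmetric tensors in U (x) ... (x) U: the product u_1 ... u_k is the
   sum of all u_(s 1) (x) ... (x) u_(s k). *)
Definition sym_power (k : nat) (I : finType) (U : {vspace vec I}) :
    {vspace tensor k I} :=
  ((\sum_(s : 'S_k) permute_factors I s) @: tensor_power k U)%VS.

(* A partition of N is the sequence of its positive parts. *)
Definition is_partition_of (N : nat) (la : seq nat) : bool :=
  [&& sorted geq la, 0%N \notin la & sumn la == N].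

(* The boxes of the diagram of la, a partition of N, are numbered 0, ..., N-1
   row by row; box a lies in row (reshape_index la a) and in column
   (reshape_offset la a). *)
Definition row_group (N : nat) (la : seq nat) : {set 'S_N} :=
  [set s : 'S_N | [forall a, reshape_index la (s a) == reshape_index la a]]%SET.

Definition column_group (N : nat) (la : seq nat) : {set 'S_N} :=
  [set s : 'S_N | [forall a, reshape_offset la (s a) == reshape_offset la a]]%SET.

Definition young_symmetrizer (N : nat) (I : finType) (la : seq nat) :
    'End(tensor N I) :=
  ((\sum_(p in row_group N la) permute_factors I p) \o
   (\sum_(q in column_group N la) (-1 : F) ^+ odd_perm q *: permute_factors I q))%VF.

(* The Schur functor of la, a partition of N, applied to W = F^I (Weyl's
   construction). *)
Definition schur_functor (N : nat) (I : finType) (la : seq nat) :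
    {vspace tensor N I} :=
  limg (young_symmetrizer N I la).

(* S^d (S^k W) is the direct sum, as a GL(W)-representation, of the S^mu W for
   mu in mus (listed with multiplicities), where W = F^I; phi j is an embedding
   of the j-th summand. *)
Definition plethysm_decomposition (I : finType) (d k : nat)
    (mus : seq (seq nat)) : Prop :=
  exists phi : 'I_(size mus) -> 'Hom(tensor (d * k) I, tensor d {ffun 'I_k -> I}),
    let S_ (j : 'I_(size mus)) := schur_functor (d * k) I (nth [::] mus j) in
    [/\ all (is_partition_of (d * k)) mus,
        forall j, (lker (phi j) :&: S_ j = 0)%VS,
        forall j (g : 'End(vec I)) t, lker g == 0%VS -> t \in S_ j ->
          phi j (tensor_map (d * k) g t) =
          tensor_map d (tensor_map k g) (phi j t),
        directv (\sum_j (phi j @: S_ j))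
      & (\sum_j (phi j @: S_ j))%VS = sym_power d (sym_power k (fullv : {vspace vec I}))].

End TensorPowers.

(* The multiplicity of S^la W in S^d (S^k W), for W = C^(d * k), which is large
   enough for every partition of d * k.  The multiplicities of a decomposition
   are unique; the default 0 of xget is never used. *)
Definition plethysm_coeff (R : realType) (d k : nat) (la : seq nat) : nat :=
  xget 0%N [set m | exists mus : seq (seq nat),
    plethysm_decomposition R[i] 'I_(d * k) d k mus /\ m = count_mem la mus].

(* Zero parts are dropped, so that 0 la is the empty partition. *)
Definition scale_partition (s : nat) (la : seq nat) : seq nat :=
  [seq x <- [seq (s * y)%N | y <- la] | x != 0%N].

Section LatticePoints.
Variable R : realType.

Definition integer_points {m : nat} : set 'rV[R]_m :=
  [set x | forall j, x ord0 j \is a Num.int].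

Definition dilate (m : nat) (s : nat) (C : set 'rV[R]_m) : set 'rV[R]_m :=
  [set s%:R *: x | x in C].

(* For compact C the set below is finite, so that this is its cardinality. *)
Definition lattice_count (m : nat) (C : set 'rV[R]_m) (s : nat) : nat :=
  #|` fset_set (dilate s C `&` integer_points)|%fset.

Definition lattice_count_combination (f : nat -> nat) : Prop :=
  exists (N : nat) (c : 'I_N -> R) (m : 'I_N -> nat)
         (C : forall i : 'I_N, set 'rV[R]_(m i)),
    [/\ forall i, 0 < c i,
        forall i, compact (C i),
        forall i, convex_set (C i : set (convex_lmodType 'rV[R]_(m i)))
      & forall s, (f s)%:R = \sum_(i < N) c i * (lattice_count (C i) s)%:R].

End LatticePoints.

(* Main.v *)
Require Import Defs.
From HB Require Import structures.
From mathcomp Require Import all_boot all_order all_algebra all_fingroup.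
From mathcomp Require Import finmap complex.
From mathcomp Require Import all_classical all_reals all_analysis.
From mathcomp Require Import ring lra zify.

(** For a two-row partition (N-j, j) of N = dk, comparing the dimensions of the
    weight spaces of weights (N-j, j) and (N-j+1, j-1) shows that its multiplicity
    in S^d(S^k W) is the number of partitions of j in a d x k box minus the number
    of those of j-1, which is symmetric in d and k.  For (7s, 5s) and
    {d, k} = {3, 4s} this gives a function f with values 1, 0, 1, 3, 2, 15 at
    0, 1, 5, 6, 7, 42.

    Suppose that f is a combination of the functions s |-> #(sC /\ Z^m).  Let A
    be the set of lattice points of 6C, and x, y its extreme points for a linear
    form that is injective on A.  The sets A + iy + (6-i)x, 0 <= i <= 6, lie in
    42C and successive ones share one point, so f 42 >= 7 f 6 - 6 f 0.  Equality
    holds, hence for every C these sets exhaust the lattice points of 42C.  This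
    forces A into the segment [x, y], and, as f 1 = 0, z |-> x + y - z then maps
    the lattice points of 7C into 5C, so f 7 <= f 5, which is false.

    That S^d(S^k W) is a sum of Schur functors at all rests on the completeness of
    the Young symmetrizers: the sums of their conjugates are pairwise orthogonal
    class functions, as numerous as the cycle types, so they span the identity.
    Positivity of the standard Hermitian form then allows Schur functors to be
    split off one at a time. *)

Set Implicit Arguments.
Unset Strict Implicit.
Unset Printing Implicit Defensive.

Import Order.TTheory GRing.Theory Num.Theory.

(** * Permutation operators on tensors *)

(** The bodies are merely compact and convex, so Ehrhart quasi-polynomials are out of reach;
    finitely many dilations are compared by adding lattice points. They are tied by 42 = 6 * 7:
    seven lattice points of 6C add up to one of 42C, and six times a lattice point of 7C lies there
    as well, so an exact description of the lattice points of 42C constrains those of 6C and of 7C.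
    On the representation side, [plethysm_coeff] takes the multiplicity in an arbitrary
    decomposition, which creates two obligations. Some decomposition must exist, for [xget] returns
    0 on an empty set; it is obtained by realising S^d(S^k W) as the image of an idempotent in the
    group algebra of the permutations of the dk tensor positions, the averaging operator of a wreath
    product. And all decompositions must agree on two-row multiplicities: a single invertible matrix
    diag(1, 2, 3, 3, ...) settles this, since its eigenvalue 2^j cuts out the weight space (dk-j, j)
    in the whole space and in every summand alike. *)

Notation word n I := {ffun 'I_n -> I}.

Section CompositionSums.
Local Open Scope ring_scope.
Variables (K : fieldType) (U V W : vectType K) (J : Type) (r : seq J) (P : pred J).

Lemma comp_lfun_suml (f : J -> 'Hom(V, W)) (g : 'Hom(U, V)) :
  ((\sum_(j <- r | P j) f j) \o g = \sum_(j <- r | P j) (f j \o g))%VF.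
Proof.
by apply: (big_morph (fun h : 'Hom(V, W) => h \o g)%VF) => [h k|];
  rewrite ?comp_lfunDl ?comp_lfun0l.
Qed.

Lemma comp_lfun_sumr (f : J -> 'Hom(U, V)) (g : 'Hom(V, W)) :
  (g \o (\sum_(j <- r | P j) f j) = \sum_(j <- r | P j) (g \o f j))%VF.
Proof.
by apply: (big_morph (fun h : 'Hom(U, V) => g \o h)%VF) => [h k|];
  rewrite ?comp_lfunDr ?comp_lfun0r.
Qed.
End CompositionSums.

Section PermutationOperators.
Local Open Scope ring_scope.
Variables (F : fieldType) (N : nat) (I : finType).
Notation T := {ffun word N I -> F^o}.
Notation rho := (@permute_factors F N I).

Lemma rhoE s (t : T) w : rho s t w = t [ffun a => w (s a)].
Proof. by rewrite lfunE /= ffunE. Qed.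

Lemma rhoM s r : (rho s \o rho r)%VF = rho (r * s)%g.
Proof.
apply/lfunP => t; apply/ffunP => w; rewrite comp_lfunE !rhoE.
by congr (t _); apply/ffunP => a; rewrite !ffunE permM.
Qed.

Lemma rho1 : rho 1%g = \1%VF.
Proof.
apply/lfunP => t; apply/ffunP => w; rewrite rhoE id_lfunE.
by congr (t _); apply/ffunP => a; rewrite ffunE perm1.
Qed.

(* The image of the group algebra of 'S_N. *)
Definition perm_op (u : 'End(T)) := exists x : {ffun 'S_N -> F}, u = \sum_s x s *: rho s.

Lemma perm_op_sum (J : Type) (r : seq J) (P : pred J) (u : J -> 'End(T)) :
  (forall j, P j -> perm_op (u j)) -> perm_op (\sum_(j <- r | P j) u j).
Proof.
move=> Pu; apply: (big_ind perm_op) => //.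
- exists [ffun => 0]; rewrite big1 // => s _; by rewrite ffunE scale0r.
- move=> _ _ [x ->] [y ->]; exists [ffun s => x s + y s].
  by rewrite -big_split; apply: eq_bigr => s _; rewrite ffunE scalerDl.
Qed.

Lemma perm_opZ k u : perm_op u -> perm_op (k *: u).
Proof.
move=> [x ->]; exists [ffun s => k * x s]; rewrite scaler_sumr.
by apply: eq_bigr => s _; rewrite ffunE scalerA.
Qed.

Lemma perm_op_rho s : perm_op (rho s).
Proof.
exists [ffun r => (r == s)%:R]; rewrite (bigD1 s) //= ffunE eqxx scale1r.
by rewrite big1 ?addr0 // => r /negPf ne; rewrite ffunE ne scale0r.
Qed.

Lemma perm_opB u v : perm_op u -> perm_op v -> perm_op (u - v).
Proof.
move=> [x ->] [y ->]; exists [ffun s => x s - y s].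
rewrite -sumrB; apply: eq_bigr => s _; by rewrite ffunE scalerBl.
Qed.

Lemma perm_op_comp u v : perm_op u -> perm_op v -> perm_op (u \o v)%VF.
Proof.
move=> [x ->] [y ->]; rewrite comp_lfun_suml; apply: perm_op_sum => s _.
rewrite comp_lfun_sumr; apply: perm_op_sum => r _.
rewrite -comp_lfunZl -comp_lfunZr rhoM.
by do 2!apply: perm_opZ; exact: perm_op_rho.
Qed.

Lemma perm_op_ind (P : 'End(T) -> Prop) :
  P 0 -> (forall u v, P u -> P v -> P (u + v)) -> (forall k s, P (k *: rho s)) ->
  forall u, perm_op u -> P u.
Proof. by move=> P0 PD PZ u [x ->]; apply: (big_ind P). Qed.

End PermutationOperators.

(** * The standard Hermitian form and adjoints of permutation operators *)

Section Adjoint.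
Local Open Scope ring_scope.
Variables (C : numClosedFieldType) (N : nat) (I : finType).
Notation T := {ffun word N I -> C^o}.
Notation rho := (@permute_factors C N I).

Definition herm (t u : T) : C := \sum_w (t w)^* * u w.

Lemma herm_gt0 t : t != 0 -> 0 < herm t t.
Proof.
move=> t0; have [w tw] : exists w, t w != 0.
  apply/existsP; apply: contraNT t0; rewrite negb_exists => /forallP z.
  by apply/eqP/ffunP => w; rewrite ffunE; apply/eqP; have := z w; rewrite negbK.
rewrite /herm (bigD1 w) //= ltr_wpDr //.
  by apply: sumr_ge0 => v _; rewrite mulrC mul_conjC_ge0.
by rewrite mulrC mul_conjC_gt0.
Qed.

Lemma herm_eq0 t : herm t t = 0 -> t = 0.
Proof. by move=> h; apply/eqP; apply: contraT => /herm_gt0; rewrite h ltxx. Qed.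

Lemma hermDl t1 t2 u : herm (t1 + t2) u = herm t1 u + herm t2 u.
Proof.
by rewrite /herm -big_split; apply: eq_bigr => w _; rewrite ffunE rmorphD mulrDl.
Qed.

Lemma hermDr t u1 u2 : herm t (u1 + u2) = herm t u1 + herm t u2.
Proof. by rewrite /herm -big_split; apply: eq_bigr => w _; rewrite ffunE mulrDr. Qed.

Lemma hermZl k t u : herm (k *: t) u = k^* * herm t u.
Proof.
by rewrite /herm mulr_sumr; apply: eq_bigr => w _; rewrite ffunE rmorphM mulrA.
Qed.

Lemma hermZr k t u : herm t (k *: u) = k * herm t u.
Proof. by rewrite /herm mulr_sumr; apply: eq_bigr => w _; rewrite ffunE mulrCA. Qed.

Lemma herm0l u : herm 0 u = 0.
Proof. by rewrite -(scale0r 0) hermZl rmorph0 mul0r. Qed.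

Lemma herm0r u : herm u 0 = 0.
Proof. by rewrite -(scale0r 0) hermZr mul0r. Qed.

(** A relation rather than an operator: every adjoint that occurs is written down explicitly as a
    combination of permutation operators. *)
Definition adjoint (u v : 'End(T)) := forall t1 t2, herm (v t1) t2 = herm t1 (u t2).

Lemma hermC t u : herm u t = (herm t u)^*.
Proof.
rewrite /herm rmorph_sum; apply: eq_bigr => w _.
by rewrite rmorphM /= conjCK mulrC.
Qed.

Lemma adjoint_sym u v : adjoint u v -> adjoint v u.
Proof. by move=> a t1 t2; rewrite hermC -a -hermC. Qed.

Lemma adjointD u v u' v' : adjoint u v -> adjoint u' v' -> adjoint (u + u') (v + v').
Proof. by move=> a b t1 t2; rewrite !lfunE hermDl hermDr a b. Qed.

Lemma adjoint0 : adjoint 0 0.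
Proof. by move=> t1 t2; rewrite !lfunE herm0l herm0r. Qed.

Lemma adjointZ k u v : adjoint u v -> adjoint (k *: u) (k^* *: v).
Proof. by move=> a t1 t2; rewrite !lfunE hermZl hermZr a conjCK. Qed.

Lemma adjoint_comp u v u' v' : adjoint u v -> adjoint u' v' -> adjoint (u \o u')%VF (v' \o v)%VF.
Proof. by move=> a b t1 t2; rewrite !comp_lfunE b a. Qed.

Lemma adjoint_sum (J : Type) (r : seq J) (P : pred J) (u v : J -> 'End(T)) :
  (forall j, P j -> adjoint (u j) (v j)) ->
  adjoint (\sum_(j <- r | P j) u j) (\sum_(j <- r | P j) v j).
Proof.
by move=> a; apply: (big_ind2 adjoint) => //; [exact: adjoint0|move=> *; exact: adjointD].
Qed.

Lemma adjoint_rho s : adjoint (rho s) (rho s^-1%g).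
Proof.
move=> t1 t2; rewrite /herm.
rewrite (reindex (fun w : word N I => [ffun a => w (s a)])) /=; last first.
  exists (fun w => [ffun a => w (s^-1 a)%g]) => w _; apply/ffunP => a.
    by rewrite !ffunE permKV.
  by rewrite !ffunE permK.
apply: eq_bigr => w _; rewrite !rhoE; congr ((t1 _)^* * _).
by apply/ffunP => a; rewrite !ffunE permKV.
Qed.

Lemma adjoint0P u v : adjoint u v -> u = 0 -> v = 0.
Proof.
move=> a u0; apply/lfunP => t; rewrite lfunE; apply: herm_eq0.
by rewrite a u0 lfunE herm0r.
Qed.

Lemma perm_op_adjoint u : perm_op u -> exists2 v, perm_op v & adjoint u v.
Proof.
move=> [x ->]; exists (\sum_s (x s)^* *: rho s^-1%g).
  by apply: perm_op_sum => s _; apply: perm_opZ; exact: perm_op_rho.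
by apply: adjoint_sum => s _; apply: adjointZ; exact: adjoint_rho.
Qed.

End Adjoint.

(** * Young diagrams *)

Section Diagrams.
Local Open Scope nat_scope.

(** Remove the maximum [M]: the other entries are distinct and smaller than [M], so there are at
    most [M] of them, with equality exactly when they fill the range below [M]. This is applied to
    the row indices of the entries of one column. *)
Lemma uniq_sum_iota (l : seq nat) :
  uniq l -> sumn (iota 0 (size l)) <= sumn l ?= iff (all (fun i => i < size l) l).
Proof.
have [n le_n] := ubnP (size l).
elim: n l le_n => // n IHn l le_n Ul.
have [->|l0] := eqVneq l [::]; first exact/leqif_refl.
have [M Ml maxM] : exists2 M, M \in l & forall i, i \in l -> i <= M.
  have : exists i, i \in l by case: l l0 {IHn le_n Ul} => // i l _; exists i; rewrite mem_head.
  move=> ex; have [|M Ml maxM] := ex_maxnP ex (m := \max_(i <- l) i).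
    by move=> i il; exact: leq_bigmax_seq.
  by exists M.
have sl : size l = (size (rem M l)).+1.
  by rewrite size_rem // prednK // lt0n size_eq0.
have rl : all (fun i => i < M) (rem M l).
  apply/allP => i; rewrite (mem_rem_uniq M Ul) inE => /andP[ne il].
  by rewrite ltn_neqAle ne maxM.
have le_sM : size (rem M l) <= M.
  rewrite -[X in _ <= X](size_iota 0 M); apply: uniq_leq_size; first exact: rem_uniq.
  by move=> i ir; rewrite mem_iota; move/allP/(_ i ir): rl.
have sumM : sumn l = sumn (rem M l) + M.
  by rewrite (perm_sumn (perm_to_rem Ml)) /= addnC.
have -> : all (fun i => i < size l) l = all (fun i => i < size (rem M l)) (rem M l) && (size (rem M l) == M).
  apply/idP/idP => [/allP h|/andP[_ /eqP sM]].
    have sM : size (rem M l) = M.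
      by apply/eqP; rewrite eqn_leq le_sM /= -ltnS -sl h.
    by rewrite sM rl eqxx.
  by apply/allP => i /maxM iM; rewrite sl sM ltnS.
rewrite sl sumM -addn1 iotaD sumn_cat /= add0n addn0.
apply: leqif_add; last exact/leqif_eq.
by apply: IHn; rewrite ?rem_uniq // -ltnS -sl.
Qed.

Variable N : nat.

Section Boxes.
Variables (mu : seq nat).
Hypothesis mu_part : is_partition_of N mu.

Definition box_row (a : 'I_N) := reshape_index mu a.
Definition box_col (a : 'I_N) := reshape_offset mu a.

Let sum_mu : sumn mu = N. Proof. by case/and3P: mu_part => _ _ /eqP. Qed.

Lemma box_row_lt a : box_row a < size mu.
Proof. by apply: reshape_indexP; rewrite sum_mu. Qed.

Lemma box_col_lt a : box_col a < nth 0 mu (box_row a).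
Proof. by apply: reshape_offsetP; rewrite sum_mu. Qed.

Lemma box_inj a b : box_row a = box_row b -> box_col a = box_col b -> a = b.
Proof.
move=> e1 e2; apply/val_inj => /=.
by rewrite -[LHS](reshape_indexK mu a) -/(box_row a) -/(box_col a) e1 e2 [LHS]reshape_indexK.
Qed.

Lemma box_exists i c : i < size mu -> c < nth 0 mu i -> exists2 a : 'I_N, box_row a = i & box_col a = c.
Proof.
move=> im cm; have lt := flatten_indexP cm.
rewrite sum_mu in lt; exists (Ordinal lt); first exact: flatten_indexKl.
exact: flatten_indexKr.
Qed.

Lemma nth_partition_le i j : i <= j -> nth 0 mu j <= nth 0 mu i.
Proof.
case/and3P: mu_part => smu _ _ ij.
have [jm|jm] := ltnP j (size mu); last by rewrite nth_default.
by apply: (sorted_leq_nth (leT := geq)) => //; [move=> x y z; exact: (rev_trans leq_trans) |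
  move=> x; exact: leqnn | rewrite inE; exact: leq_ltn_trans jm].
Qed.

Lemma nth_partition_card i : nth 0 mu i = #|[set a | box_row a == i]|.
Proof.
have [im|im] := ltnP i (size mu); last first.
  rewrite nth_default //; apply/esym/eqP; rewrite cards_eq0; apply/eqP/setP => a.
  by rewrite !inE; apply/negbTE; rewrite neq_ltn (leq_trans (box_row_lt a) im).
have [h h_row h_col] := fin_all_exists2 (fun c : 'I_(nth 0 mu i) => box_exists im (ltn_ord c)).
rewrite -[LHS]card_ord -(card_imset (f := h)); last first.
  by move=> c c' e; apply/val_inj => /=; rewrite -h_col e h_col.
congr #|pred_of_set _|; apply/setP => a; rewrite !inE; apply/imsetP/eqP => [[c _ ->]|ai].
  exact: h_row.
have ca := box_col_lt a; rewrite ai in ca.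
by exists (Ordinal ca) => //; apply: box_inj; rewrite ?h_row ?h_col.
Qed.

Definition col_rows c := [seq box_row a | a <- enum 'I_N & box_col a == c].

Lemma col_rows_uniq c : uniq (col_rows c).
Proof.
rewrite map_inj_in_uniq ?(filter_uniq _ (enum_uniq _)) // => a b.
rewrite !mem_filter => /andP[/eqP ca _] /andP[/eqP cb _] e.
by apply: box_inj => //; rewrite ca cb.
Qed.

(** Row lengths decrease, so the rows meeting a given column are closed downwards, and a
    duplicate-free list closed downwards is an initial segment. *)
Lemma mem_col_rows c i : (i \in col_rows c) = (i < size (col_rows c)).
Proof.
have down j k : j <= k -> k \in col_rows c -> j \in col_rows c.
  move=> jk /mapP[a]; rewrite mem_filter => /andP[/eqP ca _] ek.
  have := box_col_lt a; rewrite ca -ek => ck.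
  have [|b rb cb] := box_exists (i := j) (c := c) _ (leq_trans ck (nth_partition_le jk)).
    by apply: leq_ltn_trans jk _; rewrite ek box_row_lt.
  by apply/mapP; exists b; rewrite // mem_filter cb eqxx mem_enum.
apply/idP/idP => [ic|].
  rewrite -[X in X <= _](size_iota 0 i.+1); apply: uniq_leq_size; first exact: iota_uniq.
  by move=> j; rewrite mem_iota /= add0n ltnS => ji; exact: down ji ic.
apply: contraTT => ic; rewrite -leqNgt -[X in _ <= X](size_iota 0 i).
apply: uniq_leq_size; first exact: col_rows_uniq.
move=> j jc; rewrite mem_iota /= add0n ltnNge; apply: contra ic => ij; exact: down ij jc.
Qed.

Lemma col_rows_sum c : sumn (col_rows c) = sumn (iota 0 (size (col_rows c))).
Proof.
apply/eqP; rewrite eq_sym (uniq_sum_iota (col_rows_uniq c)).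
by apply/allP => i; rewrite mem_col_rows.
Qed.

End Boxes.

Lemma partition_eq mu nu : is_partition_of N mu -> is_partition_of N nu ->
  (forall i, nth 0 mu i = nth 0 nu i) -> mu = nu.
Proof.
suff le m n : is_partition_of N m -> (forall i, nth 0 m i = nth 0 n i) -> size m <= size n.
  move=> Pm Pn e; apply: (eq_from_nth (x0 := 0)) => // .
  by apply/eqP; rewrite eqn_leq !le.
move=> /and3P[_ m0 _] e; rewrite leqNgt; apply: contra m0 => lt.
by rewrite -(nth_default 0 (leqnn (size n))) -e mem_nth.
Qed.

(* The dominance argument behind von Neumann's lemma, with dominance weakened
   to the comparison of n(mu) = sum_i (i-1) mu_i. *)
Lemma tableau_straighten mu nu (s : 'S_N) :
  is_partition_of N mu -> is_partition_of N nu ->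
  (forall x y, box_row mu x = box_row mu y -> box_col nu (s x) = box_col nu (s y) -> x = y) ->
  \sum_x box_row nu x <= \sum_x box_row mu x /\
  (\sum_x box_row mu x <= \sum_x box_row nu x ->
   exists p : 'S_N, forall x, box_row nu (p x) = box_row mu x /\ box_col nu (p x) = box_col nu (s x)).
Proof.
move=> Pmu Pnu inj.
have col_ltN x : box_col nu x < N.
  apply: leq_ltn_trans (ltn_ord x); rewrite /box_col.
  rewrite -[X in _ <= X](reshape_indexK nu x) /flatten_index leq_addl //.
(* The rows in [mu] of the boxes sent by [s] into column [c] of [nu]. By hypothesis they are
   distinct, and there are as many of them as boxes in that column, so their sum is at least that of
   the rows of the column. *)
pose l c := [seq box_row mu x | x <- enum 'I_N & box_col nu (s x) == c].
have Ul c : uniq (l c).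
  rewrite map_inj_in_uniq ?(filter_uniq _ (enum_uniq _)) // => a b.
  rewrite !mem_filter => /andP[/eqP ca _] /andP[/eqP cb _] e.
  by apply: inj => //; rewrite ca cb.
have sizel c : size (l c) = size (col_rows nu c).
  rewrite !size_map -!sum1_size !big_filter !big_enum_cond /=.
  by rewrite [RHS](reindex_inj (@perm_inj _ s)).
have suml (f g : 'I_N -> nat) : (forall x, g x < N) ->
    \sum_x f x = \sum_(c < N) sumn [seq f x | x <- enum 'I_N & g x == c].
  move=> gN; rewrite (partition_big (fun x => Ordinal (gN x)) predT) //=.
  apply: eq_bigr => c _; rewrite sumnE big_map big_filter big_enum_cond /=.
  exact: eq_bigl.
rewrite (suml (box_row mu) (fun x => box_col nu (s x))) // (suml (box_row nu) (box_col nu)) //.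
have lif (c : 'I_N) : sumn (col_rows nu c) <= sumn (l c) ?= iff all (fun i => i < size (l c)) (l c).
  rewrite col_rows_sum // -sizel; exact: uniq_sum_iota.
have [le eqv] := leqif_sum (fun c (_ : xpredT c) => lif c).
split=> // ge.
have : \sum_(c < N) sumn (col_rows nu c) == \sum_(c < N) sumn (l c).
  by rewrite eqn_leq le.
rewrite eqv => /forallP all_lt.
(* Equal totals force equality column by column, so [l c] lists exactly the rows met by column [c].
   Hence [s x] can be moved within its column to the row that [x] has in [mu]. *)
have ex x : exists y, (box_row nu y == box_row mu x) && (box_col nu y == box_col nu (s x)).
  have xl : box_row mu x \in l (box_col nu (s x)).
    by apply/mapP; exists x; rewrite // mem_filter eqxx mem_enum.
  have /allP/(_ _ xl) := all_lt (Ordinal (col_ltN (s x))).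
  rewrite sizel /= -mem_col_rows // => /mapP[y]; rewrite mem_filter => /andP[cy _] ->.
  by exists y; rewrite eqxx.
have [p pP] := fin_all_exists ex.
have p_inj : injective p.
  move=> x y e; case/andP: (pP x) => /eqP r1 /eqP c1; case/andP: (pP y) => /eqP r2 /eqP c2.
  by apply: inj; rewrite -?r1 -?r2 -?c1 -?c2 e.
exists (perm p_inj) => x; rewrite permE.
by case/andP: (pP x) => /eqP -> /eqP ->.
Qed.

(** The straightening permutation carries the boxes of each row of [mu] onto those of the same row
    of [nu], so the row lengths agree. *)
Lemma tableau_straighten_eq mu nu (s : 'S_N) :
  is_partition_of N mu -> is_partition_of N nu ->
  (forall x y, box_row mu x = box_row mu y -> box_col nu (s x) = box_col nu (s y) -> x = y) ->
  \sum_x box_row mu x <= \sum_x box_row nu x -> mu = nu.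
Proof.
move=> Pmu Pnu inj le; have [_ /(_ le)[p pP]] := tableau_straighten Pmu Pnu inj.
apply: partition_eq => // i; rewrite !nth_partition_card //.
rewrite -[RHS](card_imset _ (@perm_inj _ p^-1%g)); congr #|pred_of_set _|.
apply/setP => x; rewrite !inE; apply/idP/imsetP => [xi|[y yi ->]].
  by exists (p x); rewrite ?permK // inE (pP x).1.
by rewrite inE -(permKV p y) (pP _).1 permKV in yi *.
Qed.

End Diagrams.

(** * Young symmetrizers *)

Section YoungSymmetrizers.
Local Open Scope ring_scope.
Variables (C : numClosedFieldType) (N : nat) (I : finType).
Notation T := {ffun word N I -> C^o}.
Notation rho := (@permute_factors C N I).

Definition row_sym (mu : seq nat) : 'End(T) := \sum_(p in row_group N mu) rho p.
Definition col_alt (mu : seq nat) : 'End(T) :=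
  \sum_(q in column_group N mu) (-1 : C) ^+ odd_perm q *: rho q.
Notation young mu := (@young_symmetrizer C N I mu).

Lemma row_groupP mu (s : 'S_N) : reflect (forall a, box_row mu (s a) = box_row mu a) (s \in row_group N mu).
Proof. by rewrite inE; apply: (iffP forallP) => h a; apply/eqP; exact: h. Qed.

Lemma column_groupP mu (s : 'S_N) :
  reflect (forall a, box_col mu (s a) = box_col mu a) (s \in column_group N mu).
Proof. by rewrite inE; apply: (iffP forallP) => h a; apply/eqP; exact: h. Qed.

Fact row_group_set mu : group_set (row_group N mu).
Proof.
apply/group_setP; split=> [|s r /row_groupP hs /row_groupP hr]; apply/row_groupP => a.
  by rewrite perm1.
by rewrite permM hr hs.
Qed.
Canonical row_group_group mu := Group (row_group_set mu).

Fact column_group_set mu : group_set (column_group N mu).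
Proof.
apply/group_setP; split=> [|s r /column_groupP hs /column_groupP hr]; apply/column_groupP => a.
  by rewrite perm1.
by rewrite permM hr hs.
Qed.
Canonical column_group_group mu := Group (column_group_set mu).

Lemma row_sym_op mu : perm_op (row_sym mu).
Proof. by apply: perm_op_sum => s _; exact: perm_op_rho. Qed.

Lemma col_alt_op mu : perm_op (col_alt mu).
Proof. by apply: perm_op_sum => s _; apply: perm_opZ; exact: perm_op_rho. Qed.

Lemma young_op mu : perm_op (young mu).
Proof. by apply: perm_op_comp; [exact: row_sym_op | exact: col_alt_op]. Qed.

Lemma row_sym_rho mu p : p \in row_group N mu -> (row_sym mu \o rho p)%VF = row_sym mu.
Proof.
move=> pR; rewrite comp_lfun_suml /row_sym [RHS](reindex_inj (mulgI p)) /=.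
by apply: eq_big => [r|r _]; rewrite ?rhoM // groupMl.
Qed.

Lemma rho_col_alt mu q : q \in column_group N mu ->
  (rho q \o col_alt mu)%VF = (-1) ^+ odd_perm q *: col_alt mu.
Proof.
move=> qC; rewrite comp_lfun_sumr /col_alt [in RHS](reindex_inj (mulIg q)) /= scaler_sumr.
apply: eq_big => [r|r _]; rewrite ?groupMr // -comp_lfunZr rhoM scalerA.
by rewrite odd_permM [in RHS]addbC -signr_addb addbA addbb.
Qed.

Lemma row_sym_adjoint mu : adjoint (row_sym mu) (row_sym mu).
Proof.
rewrite {2}/row_sym (reindex_inj invg_inj) /=.
under eq_bigl do rewrite groupV.
by apply: adjoint_sum => s _; exact: adjoint_rho.
Qed.

Lemma col_alt_adjoint mu : adjoint (col_alt mu) (col_alt mu).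
Proof.
rewrite {2}/col_alt (reindex_inj invg_inj) /=.
under eq_bigl do rewrite groupV.
apply: adjoint_sum => s _; rewrite odd_permV.
have {1}-> : (-1 : C) ^+ s = ((-1) ^+ s)^* by rewrite rmorphXn rmorphN rmorph1.
have := adjointZ (((-1) ^+ s)^*)%R (@adjoint_rho C N I s).
by rewrite conjCK.
Qed.

Lemma col_alt2 mu : (col_alt mu \o col_alt mu)%VF = #|column_group N mu|%:R *: col_alt mu.
Proof.
rewrite {1}/col_alt comp_lfun_suml (eq_bigr (fun _ => col_alt mu)).
  by rewrite sumr_const scaler_nat.
move=> q qC; rewrite -comp_lfunZl rho_col_alt // scalerA -signr_addb addbb.
by rewrite scale1r.
Qed.

(** The transposition of [x] and [y] is absorbed by the row symmetrizer; carried across [rho s] it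
    becomes a transposition within a column of [nu], which the column antisymmetrizer turns into a
    sign. The operator therefore equals its own negative. *)
Lemma row_rho_col_eq0 mu nu (s : 'S_N) (x y : 'I_N) : x != y ->
  box_row mu x = box_row mu y -> box_col nu (s^-1 x)%g = box_col nu (s^-1 y)%g ->
  (row_sym mu \o rho s \o col_alt nu = 0)%VF.
Proof.
move=> ne rxy cxy; set x' := (s^-1 x)%g in cxy *; set y' := (s^-1 y)%g in cxy *.
have tR : tperm x y \in row_group N mu.
  by apply/row_groupP => a; case: tpermP => // ->.
have tC : tperm x' y' \in column_group N nu.
  by apply/column_groupP => a; case: tpermP => // ->.
have ne' : x' != y' by rewrite (inj_eq perm_inj).
have e : (tperm x' y' * s = s * tperm x y)%g.
  have := tpermJ x' y' s; rewrite !permKV => <-.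
  by rewrite /conjg !mulgA mulgV mul1g.
set u := (_ \o _)%VF.
have : u = - u.
  rewrite {1}/u -(row_sym_rho tR) -(comp_lfunA (row_sym mu)) rhoM -e -rhoM !comp_lfunA.
  rewrite -comp_lfunA rho_col_alt // odd_tperm ne' expr1 -comp_lfunZr scaleN1r.
  by [].
move/eqP; rewrite -subr_eq0 opprK -mulr2n -scaler_nat scaler_eq0 pnatr_eq0 /=.
by move/eqP.
Qed.

(** Von Neumann's lemma. By linearity [u = rho s]. If two boxes collide the operator is 0; otherwise
    straightening yields a row permutation [p] with [s * p] a column permutation. Inserting [rho p]
    next to the row symmetrizer changes nothing and leaves only the sign of [s * p]. *)
Lemma young_scalar mu u : is_partition_of N mu -> perm_op u ->
  exists k, (row_sym mu \o u \o col_alt mu)%VF = k *: young mu.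
Proof.
move=> Pmu; move: u; apply: perm_op_ind.
- by exists 0; rewrite comp_lfun0r comp_lfun0l scale0r.
- move=> u v [k e] [l e']; exists (k + l).
  by rewrite comp_lfunDr comp_lfunDl e e' scalerDl.
move=> l s.
suff [k e] : exists k, (row_sym mu \o rho s \o col_alt mu)%VF = k *: young mu.
  by exists (l * k); rewrite -comp_lfunZr -comp_lfunZl e scalerA.
have [/existsP[x /existsP[y /and3P[ne /eqP rxy /eqP cxy]]]|no] :=
  boolP [exists x, exists y, [&& x != y, box_row mu x == box_row mu y
    & box_col mu (s^-1 x)%g == box_col mu (s^-1 y)%g]].
  by exists 0; rewrite scale0r; exact: row_rho_col_eq0 ne rxy cxy.
have inj x y : box_row mu x = box_row mu y -> box_col mu (s^-1 x)%g = box_col mu (s^-1 y)%g -> x = y.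
  move=> r c; apply/eqP; apply: contraNT no => ne.
  by apply/existsP; exists x; apply/existsP; exists y; rewrite ne r c !eqxx.
have [_ /(_ (leqnn _))[p pP]] := tableau_straighten Pmu Pmu inj.
have pR : p \in row_group N mu by apply/row_groupP => a; case: (pP a).
have qC : (s * p)%g \in column_group N mu.
  apply/column_groupP => a; rewrite permM.
  by case: (pP (s a)) => _ ->; rewrite permK.
exists ((-1) ^+ odd_perm (s * p)%g).
rewrite -(row_sym_rho pR) -(comp_lfunA (row_sym mu)) rhoM -comp_lfunA.
by rewrite rho_col_alt // -comp_lfunZr.
Qed.

(** Under this comparison of row sums, a permutation without collision would force [mu = nu]; so
    every permutation has a collision. *)
Lemma row_col_eq0 mu nu u : is_partition_of N mu -> is_partition_of N nu ->
  mu != nu -> (\sum_(x < N) box_row mu x <= \sum_(x < N) box_row nu x)%N -> perm_op u ->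
  (row_sym mu \o u \o col_alt nu = 0)%VF.
Proof.
move=> Pmu Pnu ne le; move: u; apply: perm_op_ind.
- by rewrite comp_lfun0r comp_lfun0l.
- by move=> u v e e'; rewrite comp_lfunDr comp_lfunDl e e' addr0.
move=> l s; rewrite -comp_lfunZr -comp_lfunZl.
have [/existsP[x /existsP[y /and3P[nxy /eqP rxy /eqP cxy]]]|no] :=
  boolP [exists x, exists y, [&& x != y, box_row mu x == box_row mu y
    & box_col nu (s^-1 x)%g == box_col nu (s^-1 y)%g]].
  by rewrite (row_rho_col_eq0 nxy rxy cxy) scaler0.
have inj x y : box_row mu x = box_row mu y -> box_col nu (s^-1 x)%g = box_col nu (s^-1 y)%g -> x = y.
  move=> r c; apply/eqP; apply: contraNT no => nxy.
  by apply/existsP; exists x; apply/existsP; exists y; rewrite nxy r c !eqxx.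
by rewrite (tableau_straighten_eq Pmu Pnu inj le) eqxx in ne.
Qed.

(** The preceding lemma covers only one order of the row sums. In the other order the inner factor,
    column antisymmetrizer of [mu], then [u], then row symmetrizer of [nu], is the adjoint of an
    operator that it does kill. *)
Lemma young_orth mu nu u : is_partition_of N mu -> is_partition_of N nu ->
  mu != nu -> perm_op u -> (young mu \o u \o young nu = 0)%VF.
Proof.
move=> Pmu Pnu ne Pu.
have [le|lt] := leqP (\sum_(x < N) box_row mu x) (\sum_(x < N) box_row nu x).
  have := row_col_eq0 Pmu Pnu ne le (perm_op_comp (col_alt_op mu) (perm_op_comp Pu (row_sym_op nu))).
  by rewrite /young_symmetrizer !comp_lfunA.
have [v Pv uv] := perm_op_adjoint Pu.
rewrite eq_sym in ne.
have e := row_col_eq0 Pnu Pmu ne (ltnW lt) Pv.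
have ad : adjoint (row_sym nu \o v \o col_alt mu)%VF (col_alt mu \o u \o row_sym nu)%VF.
  rewrite -comp_lfunA.
  exact: adjoint_comp (row_sym_adjoint nu) (adjoint_comp (adjoint_sym uv) (col_alt_adjoint mu)).
rewrite /young_symmetrizer -!(comp_lfunA (row_sym mu)) !comp_lfunA.
by rewrite -(comp_lfunA (row_sym mu)) -(comp_lfunA (row_sym mu)) (adjoint0P ad e) comp_lfun0r comp_lfun0l.
Qed.

End YoungSymmetrizers.

(** * Completeness of the Young symmetrizers *)

Section CycleTypes.
Local Open Scope nat_scope.
Variable N : nat.
Implicit Types s r : 'S_N.

(** One point per cycle, in decreasing order of cycle length, so that the cycles of two permutations
    of the same type correspond by their position in these lists. *)
Definition cycle_roots s : seq 'I_N :=
  sort (relpre (fingraph.order s) geq) [seq x <- enum 'I_N | froots s x].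

Definition cycle_type s : seq nat := [seq fingraph.order s x | x <- cycle_roots s].

Lemma mem_cycle_roots s x : (x \in cycle_roots s) = (froot s x == x).
Proof. by rewrite mem_sort mem_filter mem_enum andbT. Qed.

Lemma cycle_roots_uniq s : uniq (cycle_roots s).
Proof. by rewrite sort_uniq filter_uniq // enum_uniq. Qed.

Lemma cycle_type_partition s : is_partition_of N (cycle_type s).
Proof.
have csym := fconnect_sym (@perm_inj _ s).
apply/and3P; split.
- rewrite sorted_map; apply: sort_sorted => x y /=; exact: leq_total.
- by apply/mapP => -[x _ /eqP]; rewrite eq_sym -leqn0 leqNgt fingraph.order_gt0.
rewrite sumnE big_map (perm_big _ (permEl (perm_sort _ _))) big_filter big_enum_cond /=.
rewrite -[X in _ == X]card_ord -sum1_card [X in _ == X](partition_big (froot s) (froots s)) /=; last first.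
  by move=> x _; exact: roots_root.
apply/eqP/eq_bigr => x /eqP xr; rewrite /fingraph.order -sum1_card; apply: eq_bigl => y /=.
by rewrite -[LHS]/(fconnect s x y) -(root_connect csym) xr eq_sym.
Qed.

(** The roots are matched by position, through [phi]; the conjugator [g] sends the i-th iterate of a
    root of [s] to the i-th iterate of the corresponding root of [r]. *)
Lemma cycle_type_conj s r : cycle_type s = cycle_type r -> exists g, r = (s ^ g)%g.
Proof.
move=> e.
have cs := fconnect_sym (@perm_inj _ s); have cr := fconnect_sym (@perm_inj _ r).
have := mem_cycle_roots s; have := mem_cycle_roots r.
have := cycle_roots_uniq r; move: e; rewrite /cycle_type.
move: (cycle_roots s) (cycle_roots r) => Xs Xr e Ur memr mems.
have esz : size Xs = size Xr by rewrite -(size_map (fingraph.order s)) e size_map.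
pose phi x := nth x Xr (index x Xs).
have phi_root x : froot s x = x -> froot r (phi x) = phi x.
  move=> xs; apply/eqP; rewrite -memr mem_nth // -esz index_mem.
  by rewrite mems xs.
have phi_order x : froot s x = x -> fingraph.order r (phi x) = fingraph.order s x.
  move=> xs; have xi : x \in Xs by rewrite mems xs.
  rewrite -(nth_map x 0 (fingraph.order r)) -?esz ?index_mem // -e.
  by rewrite (nth_map x) ?index_mem // nth_index.
have phi_inj x y : froot s x = x -> froot s y = y -> phi x = phi y -> x = y.
  move=> xs ys exy.
  have xi : x \in Xs by rewrite mems xs.
  have yi : y \in Xs by rewrite mems ys.
  rewrite -(nth_index x xi) -(nth_index x yi); congr nth.
  apply/eqP; rewrite -(nth_uniq x _ _ Ur) -?esz ?index_mem //.
  by rewrite -/(phi x) exy /phi (set_nth_default x) // -esz index_mem.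
pose rt x := froot s x.
have rtK x : froot s (rt x) = rt x by exact: (eqP (roots_root cs x)).
have rt_con x : fconnect s (rt x) x by rewrite cs connect_root.
pose g x := iter (findex s (rt x) x) r (phi (rt x)).
have g_root x : froot r (g x) = phi (rt x).
  rewrite -[RHS]phi_root //; apply/esym/eqP; rewrite (root_connect cr); exact: fconnect_iter.
have g_inj : injective g.
  move=> x y exy; have exy' := exy.
  move: exy' => /(congr1 (froot r)); rewrite !g_root => /phi_inj -/(_ (rtK x) (rtK y)) ert.
  have lt z : findex s (rt z) z < fingraph.order r (phi (rt z)).
    by rewrite (phi_order _ (rtK z)); apply: findex_max; exact: rt_con.
  have /= := congr1 (findex r (phi (rt x))) exy.
  rewrite {1}/g findex_iter ?lt // ert /g findex_iter ?lt // => ei.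
  by rewrite -(iter_findex (rt_con x)) ert ei; exact: iter_findex (rt_con y).
(* The bound includes the cycle length itself, where both iterates are back at their roots: this is
   the case of the successor of the last point of a cycle. *)
have g_iter x i : froot s x = x -> i <= fingraph.order s x -> g (iter i s x) = iter i r (phi x).
  move=> xs; have rti j : rt (iter j s x) = x.
    by rewrite /rt -[RHS]xs; apply/esym/eqP; rewrite (root_connect cs); exact: fconnect_iter.
  rewrite leq_eqVlt => /orP[/eqP->|lt]; last by rewrite /g rti findex_iter.
  rewrite (iter_order (@perm_inj _ s)) -(phi_order x xs) (iter_order (@perm_inj _ r)).
  have f0 : findex s x x = 0 by rewrite -[X in findex _ _ X]/(iter 0 s x) findex_iter ?fingraph.order_gt0.
  by rewrite /g /rt xs f0.
exists (perm g_inj); apply/permP => y.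
rewrite -[y](permKV (perm g_inj)) permJ; move: ((perm g_inj)^-1 y)%g => x; rewrite !permE.
rewrite -(iter_findex (rt_con x)) -iterS !g_iter ?iterS //.
- exact: findex_max.
- by apply: ltnW; exact: findex_max.
Qed.

End CycleTypes.

(** * Central elements made from Young symmetrizers, and the identity as their combination *)

Section Completeness.
Local Open Scope ring_scope.
Variables (C : numClosedFieldType) (N : nat).
Notation I := 'I_N.
Notation T := {ffun word N I -> C^o}.
Notation rho := (@permute_factors C N I).
Notation young mu := (@young_symmetrizer C N I mu).

(* The coefficient of s in a group algebra element is read off its action on
   the word 0 1 ... N-1. *)
Definition op_coef (s : 'S_N) (u : 'End(T)) : C :=
  u [ffun w : word N I => (w == [ffun a => a])%:R : C^o] [ffun a => (s^-1 a)%g].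

Lemma op_coefE (x : 'S_N -> C) s : op_coef s (\sum_r x r *: rho r) = x s.
Proof.
rewrite /op_coef sum_lfunE sum_ffunE (bigD1 s) //= big1 => [|r ne].
  rewrite scale_lfunE ffunE rhoE ffunE [_ == _](_ : _ = true); last first.
    by apply/eqP/ffunP => a; rewrite !ffunE permK.
  by rewrite addr0 [_ *: _]mulr1.
rewrite scale_lfunE ffunE rhoE ffunE [_ == _](_ : _ = false) ?scaler0 //.
apply: contraNF ne => /eqP/ffunP e; apply/eqP/permP => a.
by have := e a; rewrite !ffunE => /(canRL (permKV s)).
Qed.

Lemma op_coefD s u v : op_coef s (u + v) = op_coef s u + op_coef s v.
Proof. by rewrite /op_coef add_lfunE ffunE. Qed.

Lemma op_coefZ s k u : op_coef s (k *: u) = k * op_coef s u.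
Proof. by rewrite /op_coef scale_lfunE ffunE. Qed.

Lemma op_coef0 s : op_coef s 0 = 0.
Proof. by rewrite /op_coef zero_lfunE ffunE. Qed.

Lemma op_coef_sum s (J : Type) (r : seq J) (P : pred J) (u : J -> 'End(T)) :
  op_coef s (\sum_(j <- r | P j) u j) = \sum_(j <- r | P j) op_coef s (u j).
Proof. by apply: (big_morph (op_coef s)); [exact: op_coefD | exact: op_coef0]. Qed.

Lemma op_coef_rho s r : op_coef s (rho r) = (r == s)%:R.
Proof.
have -> : rho r = \sum_t (r == t)%:R *: rho t.
  rewrite (bigD1 r) //= eqxx scale1r big1 ?addr0 // => t.
  by rewrite eq_sym => /negPf ->; rewrite scale0r.
by rewrite op_coefE.
Qed.

Lemma perm_op_coef u : perm_op u -> u = \sum_s op_coef s u *: rho s.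
Proof.
by move=> [x ->]; apply: eq_bigr => s _; rewrite op_coefE.
Qed.

Lemma perm_op_eq0 u : perm_op u -> (forall s, op_coef s u = 0) -> u = 0.
Proof.
by move=> Pu z; rewrite (perm_op_coef Pu) big1 // => s _; rewrite z scale0r.
Qed.

Lemma rho_conj r g : (rho g \o rho r \o rho g^-1)%VF = rho (r ^ g^-1^-1)%g.
Proof. by rewrite !rhoM /conjg !invgK. Qed.

Lemma op_coef_conj u g s : perm_op u ->
  op_coef s (rho g \o u \o rho g^-1)%VF = op_coef (s ^ g^-1)%g u.
Proof.
move=> Pu; rewrite {1}(perm_op_coef Pu) comp_lfun_sumr comp_lfun_suml.
rewrite (reindex_inj (@conjg_inj _ g^-1%g)) /=.
rewrite -[RHS](op_coefE (fun r => op_coef (r ^ g^-1)%g u)).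
congr op_coef; apply: eq_bigr => r _.
by rewrite -comp_lfunZr -comp_lfunZl rho_conj invgK conjgKV.
Qed.

Definition young_center mu : 'End(T) := \sum_(g : 'S_N) (rho g \o young mu \o rho g^-1)%VF.

Lemma young_center_op mu : perm_op (young_center mu).
Proof.
apply: perm_op_sum => g _; apply: perm_op_comp; last exact: perm_op_rho.
by apply: perm_op_comp; [exact: perm_op_rho | exact: young_op].
Qed.

(** A product of a row and a column permutation is trivial only if both factors are, because a
    permutation preserving the row and the column of every box is the identity. *)
Lemma op_coef1_young mu : is_partition_of N mu -> op_coef 1%g (young mu) = 1.
Proof.
move=> Pmu; rewrite /young_symmetrizer comp_lfun_suml op_coef_sum.
have e p : p \in row_group N mu -> op_coef 1%g (rho p \o col_alt C N 'I_N mu)%VF = (p == 1%g)%:R.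
  move=> pR; rewrite /col_alt comp_lfun_sumr op_coef_sum.
  have [->|p1] := eqVneq p 1%g.
    rewrite (bigD1 1%g) ?group1 //= big1 ?addr0 => [|q /andP[_ q1]].
      by rewrite -comp_lfunZr rhoM op_coefZ op_coef_rho mulg1 eqxx mulr1 odd_perm1.
    by rewrite -comp_lfunZr rhoM op_coefZ op_coef_rho mulg1 (negPf q1) mulr0.
  rewrite big1 // => q qC; rewrite -comp_lfunZr rhoM op_coefZ op_coef_rho.
  rewrite [_ == _](_ : _ = false) ?mulr0 //; apply: contraNF p1 => /eqP qp1.
  have pC : p \in column_group N mu.
    by rewrite -(groupMl p qC) qp1 group1.
  apply/eqP/permP => a; rewrite perm1; apply: (box_inj (mu := mu)).
    exact: (row_groupP mu p pR).
  exact: (column_groupP mu p pC).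
rewrite (eq_bigr _ e) (bigD1 1%g) ?group1 //= eqxx big1 ?addr0 // => p /andP[_ /negPf ->].
by [].
Qed.

Lemma young_center_neq0 mu : is_partition_of N mu -> young_center mu != 0.
Proof.
move=> Pmu; apply/eqP => /(congr1 (op_coef 1%g)); rewrite op_coef0 op_coef_sum.
rewrite (eq_bigr (fun=> 1)) => [|g _]; last first.
  by rewrite op_coef_conj ?conj1g ?op_coef1_young //; exact: young_op.
rewrite sumr_const => /eqP; rewrite pnatr_eq0 => /eqP c0.
by have := card0_eq c0 1%g.
Qed.

(** Taking adjoints exchanges the order of row symmetrizer and column antisymmetrizer. In the sum
    over all conjugates this order is immaterial: each row permutation moves from one end to the
    other by reindexing [g]. *)
Lemma young_center_adjoint mu : adjoint (young_center mu) (young_center mu).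
Proof.
have e : young_center mu = \sum_(g : 'S_N) (rho g \o (col_alt C N 'I_N mu \o row_sym C N 'I_N mu) \o rho g^-1)%VF.
  rewrite /young_center /young_symmetrizer.
  rewrite -/(col_alt C N 'I_N mu); move: (col_alt C N 'I_N mu) => b.
  under eq_bigr do rewrite comp_lfun_suml comp_lfun_sumr comp_lfun_suml.
  under [RHS]eq_bigr do rewrite {1}/row_sym comp_lfun_sumr comp_lfun_sumr comp_lfun_suml.
  rewrite exchange_big [RHS]exchange_big /=; apply: eq_bigr => p _.
  rewrite [RHS](reindex_inj (mulgI p)) /=; apply: eq_bigr => g _.
  rewrite -rhoM invMg -rhoM !comp_lfunA.
  by congr (_ \o _)%VF; rewrite -!comp_lfunA rhoM mulVg rho1 comp_lfun1r.
rewrite {2}e; apply: adjoint_sum => g _.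
have a := adjoint_comp (@row_sym_adjoint C N 'I_N mu) (@col_alt_adjoint C N 'I_N mu).
have b := adjoint_comp (adjoint_comp (@adjoint_rho C N 'I_N g) a) (@adjoint_rho C N 'I_N g^-1%g).
by rewrite invgK !comp_lfunA in b *.
Qed.

(** A self-adjoint operator with zero square vanishes, by positivity of the form. *)
Lemma young_center_sq_neq0 mu : is_partition_of N mu ->
  (young_center mu \o young_center mu != 0)%VF.
Proof.
move=> Pmu; apply: contraNN (young_center_neq0 Pmu) => /eqP z.
apply/eqP/lfunP => t; rewrite zero_lfunE; apply: herm_eq0.
by rewrite young_center_adjoint -comp_lfunE z zero_lfunE herm0r.
Qed.

Lemma young_center_orth mu nu : is_partition_of N mu -> is_partition_of N nu ->
  mu != nu -> (young_center mu \o young_center nu = 0)%VF.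
Proof.
move=> Pmu Pnu ne; rewrite comp_lfun_suml big1 // => g _.
rewrite comp_lfun_sumr big1 // => h _.
have := young_orth Pmu Pnu ne (perm_op_comp (@perm_op_rho C N 'I_N g^-1%g) (@perm_op_rho C N 'I_N h)).
move=> /(congr1 (fun u => rho g \o u \o rho h^-1)%VF).
by rewrite comp_lfun0r comp_lfun0l !comp_lfunA.
Qed.

Lemma op_coef_young_center mu s g : op_coef (s ^ g)%g (young_center mu) = op_coef s (young_center mu).
Proof.
rewrite -{1}(invgK g) -op_coef_conj; last exact: young_center_op.
congr op_coef; rewrite /young_center comp_lfun_sumr comp_lfun_suml.
rewrite [RHS](reindex_inj (mulIg g^-1%g)) /=; apply: eq_bigr => h _.
by rewrite invMg -!rhoM invgK !comp_lfunA.
Qed.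

(** A class function is determined by its values at one permutation of each cycle type. Taking the
    central elements of the cycle types themselves makes the matrix [M] of these values square;
    orthogonality and nonzero squares make its rows independent. So [M] is invertible, and the
    values of the identity can be solved for. *)
Lemma young_center_span : exists a : seq nat -> C,
  let P := undup [seq cycle_type s | s : 'S_N] in
  \1%VF = \sum_(mu <- P) a mu *: young_center mu.
Proof.
set P := undup _; pose n := size P.
have Ppart mu : mu \in P -> is_partition_of N mu.
  by rewrite mem_undup => /mapP[s _ ->]; exact: cycle_type_partition.
have mP (j : 'I_n) : nth [::] P j \in P by rewrite mem_nth.
have rep_ex (j : 'I_n) : exists s : 'S_N, cycle_type s == nth [::] P j.
  by have := mP j; rewrite mem_undup => /mapP[s _ ->]; exists s.
have [rep repP] := fin_all_exists rep_ex.
pose z (i : 'I_n) := young_center (nth [::] P i).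
have zero u : perm_op u -> (forall s g, op_coef (s ^ g)%g u = op_coef s u) ->
    (forall j, op_coef (rep j) u = 0) -> u = 0.
  move=> Pu cl zr; apply: perm_op_eq0 => // s.
  have sP : cycle_type s \in P by rewrite mem_undup map_f ?mem_enum.
  have lt : (index (cycle_type s) P < n)%N by rewrite index_mem.
  have := repP (Ordinal lt); rewrite /= nth_index // => /eqP/cycle_type_conj[g ->].
  by rewrite cl zr.
have lin_op (al : 'I_n -> C) : perm_op (\sum_i al i *: z i).
  by apply: perm_op_sum => i _; apply: perm_opZ; exact: young_center_op.
have lin_cl (al : 'I_n -> C) s g :
    op_coef (s ^ g)%g (\sum_i al i *: z i) = op_coef s (\sum_i al i *: z i).
  rewrite !op_coef_sum; apply: eq_bigr => i _.
  by rewrite !op_coefZ op_coef_young_center.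
pose M : 'M[C]_n := \matrix_(i, j) op_coef (rep j) (z i).
have M_unit : M \in unitmx.
  rewrite -row_free_unit -kermx_eq0; apply/rowV0P => v /sub_kermxP vM.
  have v0 : \sum_i v ord0 i *: z i = 0.
    apply: zero => // j; rewrite op_coef_sum.
    have := congr1 (fun A : 'rV_n => A ord0 j) vM; rewrite !mxE => e.
    by rewrite -[RHS]e; apply: eq_bigr => i _; rewrite op_coefZ mxE.
  apply/rowP => i; rewrite mxE.
  have /eqP := congr1 (fun u => u \o z i)%VF v0.
  rewrite comp_lfun0l comp_lfun_suml (bigD1 i) //= big1 ?addr0 => [|j ne].
    rewrite -comp_lfunZl scaler_eq0 (negPf (young_center_sq_neq0 _)) ?orbF; last exact: Ppart.
    by move/eqP.
  by rewrite -comp_lfunZl young_center_orth ?scaler0 ?Ppart // nth_uniq ?undup_uniq.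
pose v := (\row_j (1%g == rep j)%:R : 'rV[C]_n) *m invmx M.
have e1 : \1%VF = \sum_i v ord0 i *: z i.
  apply/eqP; rewrite -subr_eq0; apply/eqP; apply: zero.
  - by apply: perm_opB => //; rewrite -rho1; exact: perm_op_rho.
  - move=> s g; rewrite -scaleN1r !op_coefD !op_coefZ lin_cl -rho1 !op_coef_rho.
    by rewrite eq_sym conjg_eq1 eq_sym.
  move=> j; rewrite -scaleN1r op_coefD op_coefZ -rho1 op_coef_rho op_coef_sum.
  have := congr1 (fun A : 'rV_n => A ord0 j) (mulmxKV M_unit (\row_j (1%g == rep j)%:R)).
  rewrite !mxE => <-; rewrite mulN1r; apply/eqP; rewrite subr_eq0; apply/eqP.
  by apply: eq_bigr => i _; rewrite op_coefZ [M _ _]mxE.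
exists (fun mu => if insub (index mu P) is Some i then v ord0 i else 0).
rewrite /= e1 (big_nth [::]) big_mkord; apply: eq_bigr => i _.
by rewrite index_uniq ?undup_uniq // insubT //= => lt; congr (v _ _ *: _); apply/val_inj.
Qed.

Lemma young_complete e : perm_op e -> e != 0 ->
  exists2 mu, is_partition_of N mu & exists g, (e \o rho g \o young mu != 0)%VF.
Proof.
move=> Pe e0; have [a /= a1] := young_center_span.
move: a1; set P := undup _ => a1.
have /hasP[mu muP /existsP[g gP]] : has (fun mu => [exists g, (e \o rho g \o young mu != 0)%VF]) P.
  apply: contraNT e0 => /hasPn no.
  rewrite -(comp_lfun1r e) a1 comp_lfun_sumr big_seq big1 // => mu muP.
  rewrite -comp_lfunZr comp_lfun_sumr big1 ?scaler0 // => g _.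
  have := no _ muP; rewrite negb_exists => /forallP/(_ g); rewrite negbK => /eqP z.
  by rewrite (comp_lfunA e) (comp_lfunA e) z comp_lfun0l.
exists mu; last by exists g.
by move: muP; rewrite mem_undup => /mapP[s _ ->]; exact: cycle_type_partition.
Qed.

End Completeness.

(** * Decomposition into Schur functors *)

Section YoungDecomposition.
Local Open Scope ring_scope.
Variables (C : numClosedFieldType) (N : nat).
Notation I := 'I_N.
Notation T := {ffun word N I -> C^o}.
Notation rho := (@permute_factors C N I).
Notation young mu := (@young_symmetrizer C N I mu).
Notation a_ mu := (row_sym C N I mu).
Notation b_ mu := (col_alt C N I mu).

(** Let [v'] be the adjoint of [v]. By von Neumann's lemma, [young mu] times [a_ mu], [v'], [v] and
    [young mu] is [k] times [young mu]. Were [k] zero, positivity would first kill [b_ mu] applied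
    to [a_ mu (v' (v (young mu t)))], and then [v (young mu t)] itself. Hence [y] can be taken as
    [a_ mu] times [v'], divided by [k]. *)
Lemma young_regular mu v : is_partition_of N mu -> perm_op v -> (v \o young mu != 0)%VF ->
  exists2 y, perm_op y & (young mu \o y \o v \o young mu = young mu)%VF.
Proof.
move=> Pmu Pv vc; have [v' Pv' vv'] := perm_op_adjoint Pv.
have [k ek] := young_scalar Pmu
  (perm_op_comp (@col_alt_op C N I mu) (perm_op_comp (@row_sym_op C N I mu)
    (perm_op_comp Pv' (perm_op_comp Pv (@row_sym_op C N I mu))))).
have k0 : k != 0.
  apply: contraNneq vc => k0; apply/eqP/lfunP => t; rewrite zero_lfunE comp_lfunE.
  rewrite k0 scale0r in ek.
  have cE s : young mu s = a_ mu (b_ mu s) by rewrite comp_lfunE.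
  have ekt s : a_ mu (b_ mu (a_ mu (v' (v (a_ mu (b_ mu s)))))) = 0.
    by have /lfunP/(_ s) := ek; rewrite !comp_lfunE zero_lfunE.
  apply: herm_eq0; rewrite -vv' !cE -(@row_sym_adjoint C N I mu) -(@col_alt_adjoint C N I mu).
  suff -> : b_ mu (a_ mu (v' (v (a_ mu (b_ mu t))))) = 0 by rewrite herm0l.
  apply: herm_eq0; rewrite (@col_alt_adjoint C N I mu) -[b_ mu (b_ mu _)]comp_lfunE col_alt2 scale_lfunE hermZr.
  by rewrite (@row_sym_adjoint C N I mu) ekt herm0r mulr0.
exists (k^-1 *: (a_ mu \o v'))%VF.
  by apply: perm_opZ; apply: perm_op_comp => //; exact: row_sym_op.
apply/lfunP => t; have /lfunP/(_ t) := ek; rewrite !comp_lfunE !scale_lfunE !comp_lfunE => e.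
by rewrite !linearZ /= e scalerA mulVf // scale1r.
Qed.

(** With [u = v \o c] and [u y u = u], the operator [g = u y e] is an idempotent satisfying
    [e g = g = g e]. Its image is that of the Schur functor under [v], which is injective there
    because [c y v c = c]. The remainder [e - g] is again an idempotent combination of permutation
    operators, of smaller rank. *)
Lemma idempotent_decomposition (e : 'End(T)) : perm_op e -> (e \o e = e)%VF ->
  exists l : seq (seq nat * 'End(T)),
    [/\ forall p, p \in l -> [/\ is_partition_of N p.1, perm_op p.2
                              & (lker p.2 :&: schur_functor C N I p.1 = 0)%VS],
        (\sum_(p <- l) (p.2 @: schur_functor C N I p.1))%VS = limg e
      & (\sum_(p <- l) \dim (p.2 @: schur_functor C N I p.1))%N = \dim (limg e)].
Proof.
have [n] := ubnP (\dim (limg e)); elim: n e => // n IHn e lt_n Pe ee.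
have [->|e0] := eqVneq e 0.
  by exists [::]; rewrite !big_nil lim0g dimv0; split.
have [mu Pmu [g0 u0]] := young_complete Pe e0.
have Pv := perm_op_comp Pe (@perm_op_rho C N I g0).
have [y Py yP] := young_regular Pmu Pv u0.
have yPt s : young mu (y ((e \o rho g0)%VF (young mu s))) = young mu s.
  by rewrite -[in RHS]yP !comp_lfunE.
have ev : (e \o (e \o rho g0) = e \o rho g0)%VF by rewrite comp_lfunA ee.
have Pc : perm_op (young mu) by exact: young_op.
move: (e \o rho g0)%VF u0 yPt ev Pv {yP} => v u0 yPt ev Pv.
have limg_c : limg (young mu) = schur_functor C N I mu by [].
move: (young mu) u0 yPt Pc limg_c => c u0 yPt Pc limg_c; pose u := (v \o c)%VF.
have eu : (e \o u = u)%VF by rewrite /u comp_lfunA ev.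
have uyu : (u \o y \o u = u)%VF.
  by apply/lfunP => t; rewrite /u !comp_lfunE yPt.
have limg_u : limg u = (v @: limg c)%VS by rewrite -limg_comp.
have Pu : perm_op u by exact: perm_op_comp.
have {}u0 : u != 0 by [].
clearbody u; pose g := (u \o y \o e)%VF.
have Pg : perm_op g by apply: perm_op_comp => //; exact: perm_op_comp.
have ge : (g \o e = g)%VF by rewrite /g -comp_lfunA ee.
have eg : (e \o g = g)%VF by rewrite /g !comp_lfunA eu.
have gu : (g \o u = u)%VF by rewrite /g -comp_lfunA eu uyu.
have gg : (g \o g = g)%VF by rewrite {2}/g !comp_lfunA gu.
have limg_g : limg g = (v @: limg c)%VS.
  rewrite -limg_u; apply/eqP; rewrite eqEsubv; apply/andP; split.
    by rewrite /g -comp_lfunA limg_comp limgS ?subvf.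
  by rewrite -{1}gu limg_comp limgS ?subvf.
pose e' := e - g.
have e'e' : (e' \o e' = e')%VF.
  by rewrite /e' comp_lfunDl !comp_lfunDr !comp_lfunNl !comp_lfunNr ee ge eg gg opprK addNr addr0.
have split_e : (limg g + limg e')%VS = limg e.
  apply/eqP; rewrite eqEsubv subv_add -{1}eg limg_comp limgS ?subvf //=.
  have {1}-> : e' = (e \o e')%VF by rewrite /e' comp_lfunDr comp_lfunNr ee eg.
  rewrite limg_comp limgS ?subvf //=.
  apply/subvP => t /memv_imgP[t' _ ->]; rewrite -[e](subrKC g) -/e' add_lfunE.
  by rewrite memv_add ?memv_img ?memvf.
have disj : (limg g :&: limg e')%VS = 0%VS.
  apply/eqP; rewrite -subv0; apply/subvP => t; rewrite memv_cap memv0.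
  case/andP => /memv_imgP[s _ es] /memv_imgP[s' _ es'].
  have : g t = t by rewrite es -comp_lfunE gg.
  rewrite {1}es' -comp_lfunE /e' comp_lfunDr comp_lfunNr ge gg subrr zero_lfunE.
  by move=> <-.
have dim_e : (\dim (limg g) + \dim (limg e') = \dim (limg e))%N.
  by rewrite -split_e dimv_disjoint_sum.
have g_gt0 : (0 < \dim (limg g))%N.
  rewrite lt0n dimv_eq0; apply: contraNneq u0 => g0'; rewrite -gu.
  suff -> : g = 0 by rewrite comp_lfun0l.
  by apply/lfunP => t; apply/eqP; rewrite zero_lfunE -memv0 -g0' memv_img ?memvf.
have [|l [l1 l2 l3]] := IHn e' _ (perm_opB Pe Pg) e'e'.
  by rewrite -ltnS (leq_trans _ lt_n) // ltnS -dim_e -addn1 addnC leq_add2r.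
exists ((mu, v) :: l); split.
- move=> p; rewrite inE => /orP[/eqP->|]; last exact: l1.
  split=> //=; apply/eqP; rewrite -subv0; apply/subvP => t; rewrite memv_cap memv0 memv_ker.
  case/andP => /eqP vt; rewrite -limg_c => /memv_imgP[s _ es].
  by rewrite es -yPt -es vt !linear0.
- by rewrite big_cons /= l2 -limg_c -limg_g.
by rewrite big_cons /= l3 -limg_c -limg_g.
Qed.

End YoungDecomposition.

(** * Two-letter weight spaces of Schur functors *)

Section Supports.
Local Open Scope ring_scope.
Variables (F : fieldType) (K : finType).
Notation vec := {ffun K -> F^o}.
Implicit Types A : {set K}.

Definition eval_at (w : K) (t : vec) : F^o := t w.

Fact eval_at_is_linear w : linear (eval_at w).
Proof. by move=> c t u; rewrite /eval_at !ffunE. Qed.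
HB.instance Definition _ w := GRing.isLinear.Build F vec F^o _ (eval_at w) (@eval_at_is_linear w).

Definition supp_space A : {vspace vec} := <<[seq std_basis F w | w in A]>>%VS.

Lemma ffun_basisE (t : vec) : t = \sum_w (t w : F) *: std_basis F w.
Proof.
apply/ffunP => v; rewrite sum_ffunE (bigD1 v) //= big1 ?addr0 => [|w ne].
  by rewrite !ffunE eqxx [_ *: _]mulr1.
by rewrite !ffunE eq_sym (negPf ne) scaler0.
Qed.

Lemma supp_spaceP A (t : vec) : reflect (forall w, w \notin A -> t w = 0) (t \in supp_space A).
Proof.
apply: (iffP idP) => [tA w wA|z].
  move: t tA; suff sub : (supp_space A <= lker (linfun (eval_at w)))%VS.
    by move=> t /(subvP sub); rewrite memv_ker lfunE => /eqP.
  apply/span_subvP => _ /mapP[v vA ->]; rewrite memv_ker lfunE /= /eval_at /std_basis ffunE.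
  rewrite mem_enum in vA; case: (w =P v) => [e|_]; last by rewrite eqxx.
  by rewrite e vA in wA.
rewrite [t]ffun_basisE; apply: rpred_sum => w _.
have [wA|/z ->] := boolP (w \in A); last by rewrite scale0r mem0v.
by apply/memvZ/memv_span/map_f; rewrite mem_enum.
Qed.

End Supports.

(** * Young symmetrizers acting on words in two letters *)

Section Words.
Local Open Scope ring_scope.
Variables (C : numClosedFieldType) (N : nat).
Notation I := 'I_N.
Notation T := {ffun word N I -> C^o}.
Notation rho := (@permute_factors C N I).
Notation young mu := (@young_symmetrizer C N I mu).
Notation a_ mu := (row_sym C N I mu).
Notation b_ mu := (col_alt C N I mu).
Notation e_ := (std_basis C).

Definition permute_word (s : 'S_N) (w : word N I) : word N I := [ffun a => w (s a)].

Lemma rho_basis s (w : word N I) : rho s (e_ w) = e_ (permute_word s^-1 w).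
Proof.
apply/ffunP => v; rewrite rhoE !ffunE; congr (_%:R); congr nat_of_bool.
by apply/eqP/eqP => [<-|->]; apply/ffunP => a; rewrite !ffunE ?permK ?permKV.
Qed.

Lemma col_alt_rho mu q : q \in column_group N mu ->
  (b_ mu \o rho q)%VF = (-1) ^+ odd_perm q *: b_ mu.
Proof.
move=> qC; rewrite comp_lfun_suml /col_alt [in RHS](reindex_inj (mulgI q)) /= scaler_sumr.
apply: eq_big => [r|r _]; rewrite ?groupMl // -comp_lfunZl rhoM scalerA.
by rewrite odd_permM -signr_addb addbA addbb.
Qed.

Definition is_one (w : word N I) a := val (w a) == 1%N.

(** These words index a basis of the weight space of weight (N-j, j) in the N-th tensor power. *)
Definition two_letter_words j : {set word N I} :=
  [set w : word N I | [forall a, (val (w a) <= 1)%N] && (#|[set a | is_one w a]| == j)].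

Lemma two_letter_inj j w w' : w \in two_letter_words j -> w' \in two_letter_words j ->
  is_one w =1 is_one w' -> w = w'.
Proof.
rewrite !inE => /andP[/forallP h _] /andP[/forallP h' _] e.
apply/ffunP => a; apply/val_inj; move: (h a) (h' a) (e a); rewrite /is_one /=.
by case: (val (w a)) => [|[|?]] //; case: (val (w' a)) => [|[|?]].
Qed.

Lemma permute_two_letter s j w : w \in two_letter_words j -> permute_word s w \in two_letter_words j.
Proof.
rewrite !inE => /andP[/forallP h /eqP hj]; apply/andP; split.
  by apply/forallP => a; rewrite ffunE.
rewrite -hj -(card_imset [set a | is_one (permute_word s w) a] (@perm_inj _ s)).
apply/eqP; congr #|pred_of_set _|; apply/setP => a; rewrite inE.
apply/imsetP/idP => [[b]|h1]; first by rewrite inE /is_one ffunE => h1 ->.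
by exists (s^-1 a)%g; rewrite ?inE /is_one ?ffunE permKV.
Qed.

Lemma two_letter_exists j (P : pred 'I_N) : #|[set a | P a]| = j -> (2 * j <= N)%N ->
  exists2 w, w \in two_letter_words j & is_one w =1 P.
Proof.
(* [insubd] would fall back to [a] if the letter 1 did not exist. The bound [2 * j <= N] excludes
   this: as soon as some position carries a 1, [N] is at least 2. *)
move=> Pj jN; pose w : word N I := [ffun a => insubd a (P a : nat)].
have vw a : val (w a) = P a :> nat.
  rewrite ffunE val_insubd; case: ifP => // /negbT; rewrite -leqNgt => Nle.
  have : (0 < j)%N \/ P a = false.
    by case Pa: (P a); [left; rewrite -Pj; apply/card_gt0P; exists a; rewrite inE | right].
  have := ltn_ord a; case: (P a) Nle => /=; lia.
have ow : is_one w =1 P by move=> a; rewrite /is_one vw; case: (P a).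
exists w => //; rewrite inE; apply/andP; split.
  by apply/forallP => a; rewrite vw; case: (P a).
by rewrite -Pj; apply/eqP; congr #|pred_of_set _|; apply/setP => a; rewrite !inE ow.
Qed.

Section TwoRows.
Variables (mu : seq nat) (j : nat).
Hypotheses (Pmu : is_partition_of N mu) (jN : (2 * j <= N)%N).

Lemma young_collision (w : word N I) (x y : 'I_N) : x != y -> box_col mu x = box_col mu y -> w x = w y ->
  young mu (e_ w) = 0.
Proof.
move=> ne cxy wxy.
have tC : tperm x y \in column_group N mu.
  by apply/column_groupP => a; case: tpermP => // ->.
have e : b_ mu (e_ w) = - b_ mu (e_ w).
  rewrite -[X in X = _](_ : b_ mu (rho (tperm x y) (e_ w)) = _); last first.
    rewrite rho_basis; congr (b_ mu (e_ _)); apply/ffunP => a; rewrite ffunE tpermV.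
    by case: tpermP => // ->.
  by rewrite -comp_lfunE col_alt_rho // odd_tperm ne expr1 scaleN1r opp_lfunE.
rewrite comp_lfunE; suff -> : b_ mu (e_ w) = 0 by rewrite linear0.
move/eqP: e; rewrite -subr_eq0 opprK -mulr2n -scaler_nat scaler_eq0 pnatr_eq0 /=.
by move/eqP.
Qed.

Lemma young_swap_column (w : word N I) (x y : 'I_N) : x != y -> box_col mu x = box_col mu y ->
  young mu (e_ (permute_word (tperm x y) w)) = - young mu (e_ w).
Proof.
move=> ne cxy.
have tC : tperm x y \in column_group N mu.
  by apply/column_groupP => a; case: tpermP => // ->.
rewrite -{1}tpermV -rho_basis !comp_lfunE -[b_ mu (rho _ _)]comp_lfunE col_alt_rho //.
by rewrite odd_tperm ne expr1 scaleN1r opp_lfunE linearN.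
Qed.

(** The transposition must pass the column antisymmetrizer before the row symmetrizer can absorb it.
    It commutes with every column permutation, since [x] and [y] are alone in their columns and
    hence fixed. *)
Lemma young_swap_row (w : word N I) (x y : 'I_N) : box_row mu x = box_row mu y ->
  (forall z, box_col mu z = box_col mu x -> z = x) ->
  (forall z, box_col mu z = box_col mu y -> z = y) ->
  young mu (e_ (permute_word (tperm x y) w)) = young mu (e_ w).
Proof.
move=> rxy ax ay.
have tR : tperm x y \in row_group N mu.
  by apply/row_groupP => a; case: tpermP => // ->.
rewrite -{1}tpermV -rho_basis !comp_lfunE -[a_ mu (b_ mu (e_ w))]/((a_ mu) (b_ mu (e_ w))).
rewrite -[in RHS](row_sym_rho C I tR) [in RHS]comp_lfunE; congr (a_ mu _).
rewrite -!comp_lfunE; congr (fun_of_lfun _ _).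
rewrite comp_lfun_suml comp_lfun_sumr; apply: eq_bigr => q qC.
rewrite -comp_lfunZl -comp_lfunZr !rhoM; congr (_ *: rho _).
have fx : q x = x by apply: ax; exact: (column_groupP mu q qC).
have fy : q y = y by apply: ay; exact: (column_groupP mu q qC).
apply/permP => a; rewrite !permM.
case: (tpermP x y a) => [->|->|nx ny]; rewrite ?fx ?fy ?tpermL ?tpermR //.
by rewrite tpermD //; [rewrite -fx | rewrite -fy]; rewrite (inj_eq perm_inj) eq_sym; apply/eqP.
Qed.

Notation i := (nth 0%N mu 1).

Lemma row1_partner (x : 'I_N) : box_row mu x = 1%N ->
  exists2 y : 'I_N, box_row mu y = 0%N & box_col mu y = box_col mu x.
Proof.
move=> rx; have := box_col_lt Pmu x; rewrite rx => ci.
have s0 : (0 < size mu)%N by have := box_row_lt Pmu x; rewrite rx; lia.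
exact: box_exists s0 (leq_trans ci (nth_partition_le Pmu (leq0n 1))).
Qed.

Lemma collisionP (w : word N I) :
  (forall x y : 'I_N, x != y -> box_col mu x = box_col mu y -> w x != w y) \/ young mu (e_ w) = 0.
Proof.
have [/existsP[x /existsP[y /and3P[ne /eqP c /eqP e]]]|no] :=
  boolP [exists x : 'I_N, exists y : 'I_N, [&& x != y, box_col mu x == box_col mu y & w x == w y]].
  by right; exact: young_collision ne c e.
left=> x y ne c; apply: contraNN no => e.
by apply/existsP; exists x; apply/existsP; exists y; rewrite ne c eqxx.
Qed.

Lemma two_letter_eq (w : word N I) x y :
  w \in two_letter_words j -> is_one w x = is_one w y -> w x = w y.
Proof.
rewrite inE => /andP[/forallP h _] e; apply/val_inj; move: (h x) (h y) e; rewrite /is_one /=.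
by case: (val (w x)) => [|[|?]] //; case: (val (w y)) => [|[|?]].
Qed.

(** Two of the first three boxes of the first column carry the same letter. *)
Lemma young_many_rows w : (2 < size mu)%N -> w \in two_letter_words j -> young mu (e_ w) = 0.
Proof.
move=> s3 wA; have [inj|//] := collisionP w.
have ex r : (r < 3)%N -> exists2 a : 'I_N, box_row mu a = r & box_col mu a = 0%N.
  move=> r3; have rs := leq_trans r3 s3; apply: (box_exists Pmu rs).
  case/and3P: Pmu => _ m0 _; rewrite lt0n; apply: contraNneq m0 => <-; exact: mem_nth.
have [x rx cx] := ex 0%N isT; have [y ry cy] := ex 1%N isT; have [z rz cz] := ex 2%N isT.
have ne (a b : 'I_N) : box_row mu a != box_row mu b -> a != b by apply: contraNneq => ->.
have d (a b : 'I_N) : box_row mu a != box_row mu b -> box_col mu a = box_col mu b -> is_one w a != is_one w b.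
  move=> r c; apply: contraNneq (inj a b (ne _ _ r) c) => e; exact/eqP/two_letter_eq.
have dxy : is_one w x != is_one w y by apply: d; rewrite ?rx ?ry ?cx ?cy.
have dyz : is_one w y != is_one w z by apply: d; rewrite ?ry ?rz ?cy ?cz.
have dxz : is_one w x != is_one w z by apply: d; rewrite ?rx ?rz ?cx ?cz.
by move: dxy dyz dxz; case: (is_one w x); case: (is_one w y); case: (is_one w z).
Qed.

Lemma card_two_row_ones (w : word N I) n :
  (forall c : 'I_n, exists a : 'I_N, is_one w a && (box_col mu a == c)) ->
  (n <= #|[set a | is_one w a]|)%N.
Proof.
move=> ex; have [h hP] := fin_all_exists ex.
rewrite -[X in (X <= _)%N]card_ord -(card_imset (f := h)).
  by apply/subset_leq_card/fintype.subsetP => _ /imsetP[c _ ->]; rewrite inE; case/andP: (hP c).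
move=> c c' e; apply/val_inj => /=; case/andP: (hP c) => _ /eqP <-.
by rewrite e; case/andP: (hP c') => _ /eqP.
Qed.

(** Without a collision, each of the [i] columns meeting the second row contains a 1, which takes
    more than [j] of them. *)
Lemma young_long_row w : (j < i)%N -> w \in two_letter_words j -> young mu (e_ w) = 0.
Proof.
move=> ji wA; have [inj|//] := collisionP w.
suff : (i <= j)%N by rewrite leqNgt ji.
move: (wA); rewrite inE => /andP[_ /eqP <-]; apply: card_two_row_ones => c.
have s1 : (1 < size mu)%N by rewrite ltnNge; apply: contraTN ji => s1; rewrite nth_default.
have [x rx cx] := box_exists Pmu s1 (ltn_ord c).
have [y ry cy] := row1_partner rx.
have [ox|nx] := boolP (is_one w x); first by exists x; rewrite ox cx eqxx.
have ne : x != y by apply: contra_eqN rx => /eqP->; rewrite ry.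
exists y; rewrite cy cx eqxx andbT; apply: contraNT (inj x y ne (esym cy)) => ny.
by apply/eqP/two_letter_eq => //; rewrite (negPf nx) (negPf ny).
Qed.

(** The ones of the semistandard tableau of this shape and weight, except that those of the first
    row stand at the beginning of its overhang instead of its end. Thus each of the columns 0, ...,
    j-1 contains exactly one 1. *)
Definition standard_one (a : 'I_N) :=
  (box_row mu a == 1%N) || ((i <= box_col mu a)%N && (box_col mu a < j)%N).

Hypotheses (s2 : (size mu <= 2)%N) (ij : (i <= j)%N).

Lemma two_row_cases (a : 'I_N) : box_row mu a = 0%N \/ box_row mu a = 1%N.
Proof. by have := box_row_lt Pmu a; case: (box_row mu a) => [|[|?]]; [left|right|lia]. Qed.

Lemma card_standard : #|[set a | standard_one a]| = j.
Proof.
have Nsum : (nth 0 mu 0 + i = N)%N.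
  have /and3P[_ _ /eqP <-] := Pmu; case: (mu) s2 => [|m0 [|m1 [|]]] //= _; rewrite /= ?addn0 //.
have ex (c : 'I_j) : exists a : 'I_N, standard_one a && (box_col mu a == c).
  have [ci|ic] := ltnP c i.
    have s1 : (1 < size mu)%N by rewrite ltnNge; apply: contraTN ci => s1; rewrite nth_default.
    have [x rx cx] := box_exists Pmu s1 ci.
    by exists x; rewrite /standard_one rx cx !eqxx.
  have c0 : (c < nth 0 mu 0)%N by have := ltn_ord c; lia.
  have s0 : (0 < size mu)%N by rewrite ltnNge; apply: contraTN c0 => s0; rewrite nth_default.
  have [x rx cx] := box_exists Pmu s0 c0.
  by exists x; rewrite /standard_one rx cx ic (ltn_ord c) eqxx.
have [h hP] := fin_all_exists ex.
rewrite -[RHS]card_ord -[RHS](card_imset (f := h)); last first.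
  move=> c c' e; apply/val_inj => /=; case/andP: (hP c) => _ /eqP <-.
  by rewrite e; case/andP: (hP c') => _ /eqP.
congr #|pred_of_set _|; apply/setP => a; rewrite inE; apply/idP/imsetP => [sa|[c _ ->]]; last first.
  by case/andP: (hP c).
have caj : (box_col mu a < j)%N.
  case/orP: sa => [/eqP r1|/andP[]//].
  by have := box_col_lt Pmu a; rewrite r1; lia.
exists (Ordinal caj) => //; case/andP: (hP (Ordinal caj)) => /= + /eqP ca; set b := h _ in ca *.
move=> sb; apply: (box_inj (mu := mu)); last by rewrite ca.
have lt1 (x : 'I_N) : box_row mu x = 1%N -> (box_col mu x < i)%N.
  by move=> r1; have := box_col_lt Pmu x; rewrite r1.
move: sa sb; rewrite /standard_one.
case: (two_row_cases a) (two_row_cases b) => ra [] rb; rewrite ra rb //=.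
  by move=> /andP[+ _] _; have := lt1 b rb; rewrite ca; lia.
by move=> _ /andP[+ _]; have := lt1 a ra; rewrite ca; lia.
Qed.

Section Standard.
Variable w0 : word N I.
Hypotheses (w0A : w0 \in two_letter_words j) (w0P : is_one w0 =1 standard_one).

Lemma swap_decreases (w : word N I) x y : is_one w x != is_one w0 x ->
  is_one w y = is_one w0 x -> is_one w x = is_one w0 y ->
  (#|[set a | is_one (permute_word (tperm x y) w) a != is_one w0 a]| <
   #|[set a | is_one w a != is_one w0 a]|)%N.
Proof.
move=> ne e1 e2; apply/proper_card/properP; split.
  apply/fintype.subsetP => a; rewrite !inE {1}/is_one ffunE -/(is_one w _).
  by case: tpermP => [->|->|//]; rewrite ?e1 ?e2 ?eqxx.
exists x; first by rewrite inE.
by rewrite inE negbK /is_one ffunE tpermL; apply/eqP.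
Qed.

(** Induction on the number of positions where [w] and [w0] differ. A zero in the second row is
    exchanged with the 1 above it, at the cost of a sign. Once the second row is full of ones, a
    misplaced 1 of the first row is exchanged with a missing one, both in columns of height one, at
    no cost. *)
Lemma young_line w : w \in two_letter_words j -> young mu (e_ w) \in <[young mu (e_ w0)]>%VS.
Proof.
have [n] := ubnP #|[set a | is_one w a != is_one w0 a]|.
elim: n w => // n IHn w lt_n wA.
have [inj|->] := collisionP w; last exact: mem0v.
have part (x : 'I_N) : box_row mu x = 1%N -> exists y : 'I_N,
    [/\ box_row mu y = 0%N, box_col mu y = box_col mu x, (box_col mu y < i)%N, x != y
      & is_one w x != is_one w y].
  move=> rx; have [y ry cy] := row1_partner rx; exists y.
  have ne : x != y by apply: contra_eqN rx => /eqP->; rewrite ry.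
  split=> //; first by rewrite cy; have := box_col_lt Pmu x; rewrite rx.
  by apply: contraNneq (inj x y ne (esym cy)) => e; exact/eqP/two_letter_eq.
have next w' : (#|[set a | is_one w' a != is_one w0 a]| < #|[set a | is_one w a != is_one w0 a]|)%N ->
    w' \in two_letter_words j -> young mu (e_ w') \in <[young mu (e_ w0)]>%VS.
  by move=> lt wA'; apply: IHn => //; exact: leq_trans lt _.
have [/existsP[x /andP[/eqP rx nx]]|row1] := boolP [exists x : 'I_N, (box_row mu x == 1%N) && ~~ is_one w x].
  have [y [ry cy ci ne d]] := part x rx.
  rewrite -[young mu (e_ w)]opprK -(young_swap_column w ne (esym cy)) rpredN; apply: next; last exact: permute_two_letter.
  have o0x : is_one w0 x by rewrite w0P /standard_one rx eqxx.
  have o0y : is_one w0 y = false by rewrite w0P /standard_one ry leqNgt ci.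
  have oy : is_one w y by move: d; rewrite (negPf nx); case: (is_one w y).
  by apply: swap_decreases; rewrite ?o0x ?o0y ?oy ?(negPf nx).
have {}row1 (x : 'I_N) : box_row mu x = 1%N -> is_one w x.
  by move=> rx; apply: contraNT row1 => nx; apply/existsP; exists x; rewrite rx eqxx.
have cardw : #|[set a | is_one w a]| = j by move: wA; rewrite inE => /andP[_ /eqP].
have cardw0 : #|[set a | is_one w0 a]| = j by move: w0A; rewrite inE => /andP[_ /eqP].
have [sub|/fintype.subsetPn[x]] := boolP ([set a | is_one w a] \subset [set a | is_one w0 a]).
  have /eqP/setP e : [set a | is_one w a] == [set a | is_one w0 a].
    by rewrite eqEcard sub cardw cardw0 leqnn.
  rewrite (two_letter_inj wA w0A) ?memv_line // => a.
  by have := e a; rewrite !inE.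
have [sub|/fintype.subsetPn[y]] := boolP ([set a | is_one w0 a] \subset [set a | is_one w a]).
  have /eqP/setP e : [set a | is_one w0 a] == [set a | is_one w a].
    by rewrite eqEcard sub cardw cardw0 leqnn.
  rewrite (two_letter_inj wA w0A) ?memv_line // => a.
  by have := e a; rewrite !inE.
rewrite !inE => oy ny ox nx.
have rx : box_row mu x = 0%N.
  by have [//|r1] := two_row_cases x; move: nx; rewrite w0P /standard_one r1.
have ry : box_row mu y = 0%N by have [//|/row1] := two_row_cases y; rewrite (negPf ny).
have cy : (i <= box_col mu y)%N by move: oy; rewrite w0P /standard_one ry => /andP[].
have cx : (i <= box_col mu x)%N.
  rewrite leqNgt; apply/negP => ci.
  have s1 : (1 < size mu)%N by rewrite ltnNge; apply: contraTN ci => s1; rewrite nth_default.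
  have [z rz cz] := box_exists Pmu s1 ci.
  have [x' [rx' cx' _ _]] := part z rz.
  by rewrite (row1 z rz) (_ : x' = x) ?ox //; apply: (box_inj (mu := mu)); rewrite ?rx ?rx' ?cx'.
have alone (x' z : 'I_N) : box_row mu x' = 0%N ->
    (i <= box_col mu x')%N -> box_col mu z = box_col mu x' -> z = x'.
  move=> rx' ix' cz; apply: (box_inj (mu := mu)) => //; rewrite rx'.
  have [//|r1] := two_row_cases z.
  by have := box_col_lt Pmu z; rewrite r1 cz; lia.
have rxy : box_row mu x = box_row mu y by rewrite rx ry.
rewrite -(young_swap_row w rxy (fun z => alone x z rx cx) (fun z => alone y z ry cy)).
apply: next; last exact: permute_two_letter.
by apply: swap_decreases; rewrite ?ox ?oy ?(negPf nx) ?(negPf ny).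
Qed.

(** The coefficient of [w0] in its own image is the number of row permutations fixing [w0]; no signs
    cancel, as only the trivial column permutation contributes. One exchanging the two boxes of a
    column takes a first-row box where [w0] has 0 into the second row, where every row permutation
    still finds a 1. *)
Lemma young_standard_neq0 : young mu (e_ w0) != 0.
Proof.
suff : young mu (e_ w0) w0 != 0 by apply: contraNneq => ->; rewrite ffunE.
have q1 (p q : 'S_N) : p \in row_group N mu -> q \in column_group N mu ->
    (permute_word q (permute_word p w0) == w0) = (q == 1%g) && (permute_word p w0 == w0).
  move=> pR qC; apply/eqP/andP => [e|[/eqP-> /eqP->]]; last first.
    by apply/ffunP => a; rewrite ffunE perm1.
  have eo a : is_one w0 (p (q a)) = is_one w0 a.
    by have := congr1 (fun v => is_one v a) e; rewrite /is_one !ffunE.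
  have fix1 (a : 'I_N) : box_row mu a = 1%N -> q a = a.
    move=> ra; apply: (box_inj (mu := mu)); last exact: (column_groupP mu q qC).
    have [r0|->//] := two_row_cases (q a).
    set b := q a in r0.
    have cb : box_col mu b = box_col mu a by exact: (column_groupP mu q qC).
    have ca : (box_col mu a < i)%N by have := box_col_lt Pmu a; rewrite ra.
    have rqb : box_row mu (q b) = 1%N.
      have [rqb|//] := two_row_cases (q b).
      have : q b = b.
        by apply: (box_inj (mu := mu)); rewrite ?rqb ?r0 // (column_groupP mu q qC).
      by move=> /perm_inj ba; move: r0; rewrite ba ra.
    have sb : standard_one b = false by rewrite /standard_one r0 cb /= leqNgt ca.
    by have := eo b; rewrite !w0P sb /standard_one (row_groupP mu p pR) rqb.
  have qe : q = 1%g.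
    apply/permP => a; rewrite perm1; have [r0|/fix1//] := two_row_cases a.
    have [rq|rq] := two_row_cases (q a).
      by apply: (box_inj (mu := mu)); rewrite ?rq ?r0 // (column_groupP mu q qC).
    by have := fix1 _ rq => /perm_inj.
  split; first exact/eqP.
  apply/eqP; rewrite -[RHS]e qe; apply/ffunP => a; by rewrite [in RHS]ffunE perm1.
have -> : young mu (e_ w0) w0 = #|[set p in row_group N mu | permute_word p w0 == w0]|%:R.
  rewrite comp_lfunE sum_lfunE sum_ffunE -sum1_card natr_sum big_mkcond [RHS]big_mkcond /=.
  apply: eq_bigr => p _; rewrite [p \in [set _ in _ | _]]finset.in_set.
  case: (boolP (p \in row_group N mu)) => //= pR.
  rewrite rhoE sum_lfunE sum_ffunE (bigD1 1%g) ?group1 //= big1 ?addr0 => [|q /andP[qC q0]].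
    rewrite odd_perm1 scale1r rho1 id_lfunE ffunE -/(permute_word p w0).
    by case: ifP.
  rewrite scale_lfunE ffunE rhoE ffunE -/(permute_word p w0) -/(permute_word q _).
  by rewrite q1 // (negPf q0) scaler0.
rewrite pnatr_eq0 -lt0n; apply/card_gt0P; exists 1%g; rewrite inE group1 /=.
by apply/eqP/ffunP => a; rewrite ffunE perm1.
Qed.

End Standard.
End TwoRows.

(* The Kostka number of mu and the weight (N-j, j). *)
Lemma schur_weight_dim mu j : is_partition_of N mu -> (2 * j <= N)%N ->
  \dim (schur_functor C N I mu :&: supp_space C (two_letter_words j)) =
    (size mu <= 2)%N && (nth 0%N mu 1 <= j)%N.
Proof.
move=> Pmu jN; set A := two_letter_words j.
(* The symmetrizer preserves both the span of the words in [A] and that of the words outside [A], so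
   restricting its image to [A] amounts to restricting its argument. *)
have imE : (schur_functor C N I mu :&: supp_space C A = young mu @: supp_space C A)%VS.
  have stab t : t \in supp_space C A -> young mu t \in supp_space C A.
    move=> tA; move: (@young_op C N I mu); move: (young mu); apply: perm_op_ind.
    - by rewrite zero_lfunE mem0v.
    - by move=> u v; rewrite add_lfunE => ? ?; rewrite rpredD.
    move=> k s; rewrite scale_lfunE memvZ //; apply/supp_spaceP => w wA.
    rewrite rhoE; apply: (supp_spaceP _ _ tA); apply: contra wA => h.
    have := permute_two_letter s^-1 h; rewrite -/A [permute_word _ _](_ : _ = w) //.
    by apply/ffunP => a; rewrite !ffunE permKV.
  apply/eqP; rewrite eqEsubv; apply/andP; split; last first.
    apply/subvP => _ /memv_imgP[t tA ->]; rewrite memv_cap stab // andbT.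
    by rewrite memv_img ?memvf.
  apply/subvP => v; rewrite memv_cap => /andP[/memv_imgP[t _ ->]] vA.
  pose t1 : T := [ffun w => if w \in A then t w else 0].
  pose t2 : T := [ffun w => if w \in A then 0 else t w].
  have tE : t = t1 + t2.
    by apply/ffunP => w; rewrite !ffunE; case: ifP; rewrite ?addr0 ?add0r.
  have t1A : t1 \in supp_space C A.
    by apply/supp_spaceP => w /negPf wA; rewrite ffunE wA.
  suff -> : young mu t = young mu t1 by exact: memv_img.
  rewrite {1}tE linearD /= [young mu t2](_ : _ = 0) ?addr0 //.
  have t2A : forall w, w \in A -> young mu t2 w = 0.
    move: (@young_op C N I mu); move: (young mu); apply: perm_op_ind.
    - by move=> w _; rewrite zero_lfunE ffunE.
    - by move=> u u2 hu hv w wA; rewrite add_lfunE ffunE hu // hv // addr0.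
    move=> k s w wA; rewrite scale_lfunE ffunE rhoE ffunE.
    by rewrite (permute_two_letter s wA : [ffun a => w (s a)] \in A) scaler0.
  apply/ffunP => w; rewrite [RHS]ffunE; have [/t2A//|wA] := boolP (w \in A).
  have := supp_spaceP _ _ vA w wA; rewrite tE linearD /= ffunE.
  by rewrite (supp_spaceP _ _ (stab _ t1A)) // add0r.
rewrite imE /supp_space limg_span -map_comp -[map _ _]/[seq young mu (e_ w) | w in A].
have zero : (forall w, w \in A -> young mu (e_ w) = 0) -> \dim <<[seq young mu (e_ w) | w in A]>> = 0%N.
  move=> z; apply/eqP; rewrite dimv_eq0 -subv0; apply/span_subvP => _ /mapP[w wA ->] /=.
  by rewrite mem_enum in wA; rewrite z // mem0v.
have [s3|s2] := ltnP 2 (size mu).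
  by rewrite zero //= => w; exact: young_many_rows.
have [ij|ji] := leqP (nth 0%N mu 1) j; last by rewrite zero //= => w; exact: young_long_row.
have [w0 w0A w0P] := two_letter_exists (card_standard Pmu jN s2 ij) jN.
have -> : <<[seq young mu (e_ w) | w in A]>>%VS = <[young mu (e_ w0)]>%VS.
  apply/eqP; rewrite eqEsubv; apply/andP; split.
    apply/span_subvP => _ /mapP[w wA ->] /=; rewrite mem_enum in wA.
    exact: young_line w0A w0P _ wA.
  by rewrite -memvE; apply/memv_span/mapP; exists w0; rewrite // mem_enum.
by rewrite dim_vline (young_standard_neq0 Pmu jN s2 ij w0P).
Qed.

End Words.

(** * Symmetric powers *)

Section TensorMaps.
Local Open Scope ring_scope.
Variables (F : fieldType) (I : finType).

Lemma tensor_mapE k (g : 'End({ffun I -> F^o})) (t : {ffun word k I -> F^o}) w :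
  tensor_map k g t w = \sum_f (t f : F) * \prod_a g (std_basis F (f a)) (w a).
Proof.
rewrite lfunE /= /tensor_map_fun sum_ffunE; apply: eq_bigr => f _.
by rewrite !ffunE.
Qed.

Lemma tensor_map_basisE k (g : 'End({ffun I -> F^o})) (f w : word k I) :
  tensor_map k g (std_basis F f) w = \prod_a g (std_basis F (f a)) (w a).
Proof.
rewrite tensor_mapE (bigD1 f) //= ffunE eqxx mul1r [X in _ + X]big1 ?addr0 // => h ne.
by rewrite ffunE (negPf ne) mul0r.
Qed.

Lemma tensor_map_rho N (g : 'End({ffun I -> F^o})) s (t : {ffun word N I -> F^o}) :
  permute_factors F I s (tensor_map N g t) = tensor_map N g (permute_factors F I s t).
Proof.
apply/ffunP => w; rewrite rhoE !tensor_mapE.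
rewrite [RHS](reindex (fun f : word N I => [ffun a => f (s^-1 a)%g])) /=; last first.
  exists (fun f => [ffun a => f (s a)]) => f _; apply/ffunP => a.
    by rewrite !ffunE permK.
  by rewrite !ffunE permKV.
apply: eq_bigr => f _; rewrite rhoE; congr (t _ * _).
  by apply/ffunP => a; rewrite !ffunE permK.
rewrite [RHS](reindex_inj (@perm_inj _ s)) /=; apply: eq_bigr => a _.
by rewrite !ffunE permK.
Qed.

Lemma tensor_map_perm_op N (g : 'End({ffun I -> F^o})) u (t : {ffun word N I -> F^o}) :
  perm_op u -> u (tensor_map N g t) = tensor_map N g (u t).
Proof.
move=> [x ->]; rewrite !sum_lfunE linear_sum; apply: eq_bigr => s _.
by rewrite !scale_lfunE linearZ tensor_map_rho.
Qed.

End TensorMaps.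

Section SymmetricPowers.
Local Open Scope ring_scope.
Variables (C : numClosedFieldType) (I : finType).
Notation vec I := {ffun I -> C^o}.
Notation tensor k I := {ffun word k I -> C^o}.

Lemma natC_fact_neq0 n : (n`!%:R : C) != 0.
Proof. by rewrite pnatr_eq0 -lt0n fact_gt0. Qed.

Lemma pure_tensor_rho (J : finType) k (s : 'S_k) (u : 'I_k -> vec J) :
  permute_factors C J s (pure_tensor u) = pure_tensor (fun a => u (s^-1 a)%g).
Proof.
apply/ffunP => w; rewrite rhoE !ffunE [RHS](reindex_inj (@perm_inj _ s)) /=.
by apply: eq_bigr => a _; rewrite ffunE permK.
Qed.

Lemma tensor_power_rho (J : finType) k (U : {vspace vec J}) (s : 'S_k) t :
  t \in tensor_power k U -> permute_factors C J s t \in tensor_power k U.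
Proof.
move=> tU; suff sub : (permute_factors C J s @: tensor_power k U <= tensor_power k U)%VS.
  by apply: (subvP sub); exact: memv_img.
rewrite limg_span; apply/span_subvP => _ /mapP[_ /mapP[f _ ->] ->].
rewrite pure_tensor_rho; apply/memv_span/mapP; exists [ffun a => f (s^-1 a)%g]; rewrite ?mem_enum //.
by apply/ffunP => w; rewrite !ffunE; apply: eq_bigr => a _; rewrite ffunE.
Qed.

Lemma pure_tensor_mem (J : finType) k (U : {vspace vec J}) (u : 'I_k -> vec J) :
  (forall a, u a \in U) -> pure_tensor u \in tensor_power k U.
Proof.
move=> uU; pose X a i := coord (vbasis U) i (u a).
have -> : pure_tensor u = \sum_(f : {ffun 'I_k -> 'I_(\dim U)})
    (\prod_a X a (f a)) *: pure_tensor (fun a => (vbasis U)`_(f a)).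
  apply/ffunP => w; rewrite sum_ffunE ffunE.
  transitivity (\prod_a \sum_i X a i * (vbasis U)`_i (w a)).
    apply: eq_bigr => a _; rewrite {1}(coord_vbasis (uU a)) sum_ffunE.
    by apply: eq_bigr => i _; rewrite ffunE.
  rewrite bigA_distr_bigA /=; apply: eq_bigr => f _.
  by rewrite !ffunE big_split.
apply: rpred_sum => f _; apply/memvZ/memv_span/mapP; exists f; rewrite ?mem_enum //.
Qed.

Lemma sym_powerP (J : finType) k (U : {vspace vec J}) t :
  reflect (t \in tensor_power k U /\ forall s, permute_factors C J s t = t)
    (t \in sym_power k U).
Proof.
apply: (iffP memv_imgP) => [[v vU ->]|[tU ts]].
  split.
    by rewrite sum_lfunE rpred_sum // => s _; exact: tensor_power_rho.
  move=> s; rewrite -comp_lfunE comp_lfun_sumr [in RHS](reindex_inj (mulIg s)) /=.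
  by congr fun_of_lfun; apply: eq_bigr => r _; rewrite rhoM.
exists ((k`!)%:R^-1 *: t); first exact: memvZ.
rewrite linearZ /= sum_lfunE (eq_bigr (fun=> t)) // sumr_const.
by rewrite -scaler_nat scalerA card_Sn mulVf ?scale1r ?natC_fact_neq0.
Qed.

Lemma tensor_power_full (J : finType) k : tensor_power k {:vec J}%VS = fullv.
Proof.
apply/eqP; rewrite eqEsubv subvf; apply/subvP => t _.
have -> : t = \sum_f (t f : C) *: pure_tensor (fun a => std_basis C (f a)).
  apply/ffunP => w; rewrite sum_ffunE (bigD1 w) //= big1 ?addr0 => [|f ne].
    rewrite !ffunE big1 ?[_ *: _]mulr1 // => a _.
    by rewrite ffunE eqxx.
  rewrite !ffunE; have [a ne_a] : exists a, f a != w a.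
    apply/existsP; apply: contraNT ne; rewrite negb_exists => /forallP e.
    by apply/eqP/ffunP => a; apply/eqP; have := e a; rewrite negbK.
  by rewrite (bigD1 a) //= ffunE eq_sym (negPf ne_a) mul0r scaler0.
by apply: rpred_sum => f _; apply/memvZ/pure_tensor_mem => a; exact: memvf.
Qed.

Variables (d k : nat).
Notation J := (word k I).

Definition slotwise (tau : {ffun 'I_d -> 'S_k}) (f : word d J) : word d J :=
  [ffun a => [ffun b => f a (tau a b)]].

Lemma sym_power_fullP (t : tensor k I) :
  reflect (forall (s : 'S_k) (f : J), t [ffun b => f (s b)] = t f) (t \in sym_power k {:vec I}%VS).
Proof.
apply: (iffP (sym_powerP _ _)) => [[_ h] s f|h].
  by rewrite -[in RHS](h s) rhoE.
split; first by rewrite tensor_power_full memvf.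
by move=> s; apply/ffunP => f; rewrite rhoE.
Qed.

(** Turns the iterated symmetric power into the functions invariant under permutations inside each
    slot and permutations of the slots, the form in which it is compared with wreath product
    invariants. *)
Lemma sym_sym_powerP (t : tensor d J) :
  reflect ((forall tau (f : word d J), t (slotwise tau f) = t f) /\
           (forall (s : 'S_d) (f : word d J), t [ffun a => f (s a)] = t f))
    (t \in sym_power d (sym_power k {:vec I}%VS)).
Proof.
set U := sym_power k _.
apply: (iffP (sym_powerP _ _)) => [[tU h]|[h1 h2]]; split.
- move=> tau f; pose S := [ffun w => t (slotwise tau w) - t w] : tensor d J.
  suff : S = 0 by move=> /ffunP/(_ f); rewrite !ffunE => /eqP; rewrite subr_eq0 => /eqP.
  rewrite {}/S; move: t tU {h}.
  have lin : linear (fun t : tensor d J => [ffun w => t (slotwise tau w) - t w] : tensor d J).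
    move=> c u v; apply/ffunP => w; rewrite !ffunE scalerBr.
    by rewrite -!addrA; congr (_ + _); rewrite opprD addrCA.
  pose phi := GRing.isLinear.Build C (tensor d J) (tensor d J) _ _ lin.
  pose L : {linear tensor d J -> tensor d J} :=
    HB.pack (fun t : tensor d J => [ffun w => t (slotwise tau w) - t w] : tensor d J) phi.
  suff sub : (tensor_power d U <= lker (linfun L))%VS.
    by move=> t /(subvP sub); rewrite memv_ker lfunE /= => /eqP.
  apply/span_subvP => _ /mapP[g _ ->]; rewrite memv_ker lfunE /=.
  apply/eqP/ffunP => w; rewrite !ffunE; apply/eqP; rewrite subr_eq0; apply/eqP.
  apply: eq_bigr => a _; rewrite ffunE.
  have uU : (vbasis U)`_(g a) \in U by apply: vbasis_mem; rewrite mem_nth ?size_tuple.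
  exact: (sym_power_fullP _ uU).
- by move=> s f; rewrite -[in RHS](h s) rhoE.
- have card_gt0 : (#|{ffun 'I_d -> 'S_k}|%:R : C) != 0.
    by rewrite pnatr_eq0 -lt0n; apply/card_gt0P; exists [ffun=> 1%g].
  (* Symmetrizing every slot of each basis tensor in the expansion of a slotwise invariant [t]
     multiplies [t] by the number of families [tau]; the terms so obtained are pure tensors with
     factors in [U]. *)
  pose u (f : word d J) (a : 'I_d) : vec J := \sum_(s : 'S_k) std_basis C [ffun b => f a (s b)].
  have uU f a : u f a \in U.
    apply/sym_power_fullP => s h; rewrite /u !sum_ffunE.
    rewrite [RHS](reindex_inj (mulgI s^-1%g)) /=; apply: eq_bigr => r _; rewrite !ffunE.
    congr (_%:R); congr nat_of_bool; apply/eqP/eqP => /ffunP e; apply/ffunP => b.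
      by have := e (s^-1 b)%g; rewrite !ffunE permKV permM.
    by have := e (s b); rewrite !ffunE permM permK.
  have -> : t = (#|{ffun 'I_d -> 'S_k}|%:R)^-1 *: \sum_(f : word d J) (t f : C) *: pure_tensor (u f).
    apply/ffunP => w; rewrite ffunE sum_ffunE.
    have e f : pure_tensor (u f) w = \sum_(tau : {ffun 'I_d -> 'S_k}) (slotwise tau f == w)%:R.
      rewrite ffunE; under eq_bigr do rewrite sum_ffunE.
      rewrite bigA_distr_bigA /=; apply: eq_bigr => tau _.
      have [<-|ne] := eqVneq (slotwise tau f) w.
        by rewrite big1 // => a _; rewrite !ffunE; case: eqP => // -[]; apply/ffunP => b; rewrite !ffunE.
      have [a ne_a] : exists a, slotwise tau f a != w a.
        apply/existsP; apply: contraNT ne; rewrite negb_exists => /forallP z.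
        by apply/eqP/ffunP => a; apply/eqP; have := z a; rewrite negbK.
      rewrite (bigD1 a) //= ffunE (_ : (_ == _) = false) ?mul0r //.
      by apply/negbTE; apply: contraNN ne_a => /eqP ->; apply/eqP/ffunP => b; rewrite !ffunE.
    transitivity (#|{ffun 'I_d -> 'S_k}|%:R^-1 * \sum_(tau : {ffun 'I_d -> 'S_k}) t w : C); last first.
      congr (_ * _); under [RHS]eq_bigr do rewrite ffunE e [_ *: _]mulr_sumr.
      rewrite exchange_big /=; apply: eq_bigr => tau _.
      pose tau' := [ffun a => (tau a)^-1%g] : {ffun 'I_d -> 'S_k}.
      have sK f : slotwise tau (slotwise tau' f) = f.
        by apply/ffunP => a; apply/ffunP => b; rewrite !ffunE permK.
      have sK' f : slotwise tau' (slotwise tau f) = f.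
        by apply/ffunP => a; apply/ffunP => b; rewrite !ffunE permKV.
      rewrite (bigD1 (slotwise tau' w)) //= sK eqxx mulr1 h1 big1 ?addr0 // => f ne.
      rewrite (_ : (_ == _) = false) ?mulr0 //; apply: contraNF ne => /eqP <-.
      by rewrite sK'.
    by rewrite sumr_const -[t w *+ _]mulr_natl mulrA mulVf ?mul1r.
  by apply/memvZ/rpred_sum => f _; apply/memvZ/pure_tensor_mem.
- by move=> s; apply/ffunP => f; rewrite rhoE.
Qed.

End SymmetricPowers.

(** * The dk-th tensor power as the d-th tensor power of the k-th one *)

Section Regrouping.
Local Open Scope ring_scope.
Variables (d k : nat).

Definition slot (c : 'I_(d * k)) : 'I_d * 'I_k := enum_val (cast_ord (esym (mxvec_cast d k)) c).

Lemma slotK a b : slot (mxvec_index a b) = (a, b).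
Proof. by rewrite /slot /mxvec_index cast_ordK enum_rankK. Qed.

Lemma mxvec_slotK c : mxvec_index (slot c).1 (slot c).2 = c.
Proof. by case/mxvec_indexP: c => a b; rewrite slotK. Qed.

Lemma big_slot (R : Type) (idx : R) (op : Monoid.com_law idx) (f : 'I_(d * k) -> R) :
  \big[op/idx]_c f c = \big[op/idx]_a \big[op/idx]_b f (mxvec_index a b).
Proof.
rewrite pair_bigA /= (reindex (fun p : 'I_d * 'I_k => mxvec_index p.1 p.2)) //.
exists slot => [[a b]|c] _ /=; [exact: slotK | exact: mxvec_slotK].
Qed.

Variable I : finType.

Definition concat_word (f : word d (word k I)) : word (d * k) I :=
  [ffun c => f (slot c).1 (slot c).2].

Definition split_word (w : word (d * k) I) : word d (word k I) :=
  [ffun a => [ffun b => w (mxvec_index a b)]].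

Lemma concat_wordK : cancel concat_word split_word.
Proof.
by move=> f; apply/ffunP => a; apply/ffunP => b; rewrite !ffunE slotK.
Qed.

Lemma split_wordK : cancel split_word concat_word.
Proof. by move=> w; apply/ffunP => c; rewrite !ffunE mxvec_slotK. Qed.

Variable F : fieldType.
Notation vec I := {ffun I -> F^o}.

Definition regroup_fun (t : vec (word (d * k) I)) : vec (word d (word k I)) :=
  [ffun f => t (concat_word f)].

Fact regroup_fun_is_linear : linear regroup_fun.
Proof. by move=> c t u; apply/ffunP => f; rewrite !ffunE. Qed.
HB.instance Definition _ := GRing.isLinear.Build F _ _ _ regroup_fun regroup_fun_is_linear.

Definition regroup : 'Hom(vec (word (d * k) I), vec (word d (word k I))) := linfun regroup_fun.

Lemma regroupE t f : regroup t f = t (concat_word f).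
Proof. by rewrite lfunE ffunE. Qed.

Lemma regroup_ker : lker regroup = 0%VS.
Proof.
apply/eqP/lker0P => t u e; apply/ffunP => w.
by have := congr1 (fun v : vec _ => v (split_word w)) e; rewrite /= !regroupE split_wordK.
Qed.

Lemma regroup_tensor_map (g : 'End(vec I)) t :
  regroup (tensor_map (d * k) g t) = tensor_map d (tensor_map k g) (regroup t).
Proof.
apply/ffunP => f; rewrite regroupE !tensor_mapE (reindex concat_word) /=; last first.
  by exists split_word => ? _; rewrite ?concat_wordK ?split_wordK.
apply: eq_bigr => h _; rewrite regroupE; congr (_ * _).
rewrite big_slot; apply: eq_bigr => a _; rewrite tensor_map_basisE.
by apply: eq_bigr => b _; rewrite !ffunE slotK.
Qed.

End Regrouping.

(** * S^d(S^k W) as a space of wreath product invariants *)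

Section Wreath.
Local Open Scope ring_scope.
Variables (C : numClosedFieldType) (d k : nat).
Notation N := (d * k)%N.
Notation I := 'I_N.
Notation T := {ffun word N I -> C^o}.

(** The wreath product of S_k by S_d, acting on the d x k array of tensor positions: [s] permutes
    the rows of the array and [tau a] the entries of row [a]. *)
Definition wreath : {set 'S_N} :=
  [set g : 'S_N | [exists s : 'S_d, exists tau : {ffun 'I_d -> 'S_k},
    forall a, forall b, g (mxvec_index a b) == mxvec_index (s a) (tau a b)]].

Lemma wreathP (g : 'S_N) : reflect (exists (s : 'S_d) (tau : {ffun 'I_d -> 'S_k}),
    forall a b, g (mxvec_index a b) = mxvec_index (s a) (tau a b)) (g \in wreath).
Proof.
rewrite inE; apply: (iffP existsP) => [[s /existsP[tau /forallP h]]|[s [tau h]]].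
  by exists s, tau => a b; move/forallP/(_ b)/eqP: (h a).
exists s; apply/existsP; exists tau; apply/forallP => a; apply/forallP => b.
exact/eqP.
Qed.

Fact wreath_set : group_set wreath.
Proof.
apply/group_setP; split=> [|g h /wreathP[s [tau e]] /wreathP[r [ups e']]]; apply/wreathP.
  by exists 1%g, [ffun=> 1%g] => a b; rewrite ffunE !perm1.
exists (s * r)%g, [ffun a => tau a * ups (s a)]%g => a b.
by rewrite ffunE !permM e e'.
Qed.
Canonical wreath_group := Group wreath_set.

Lemma wreath_perm (s : 'S_d) (tau : {ffun 'I_d -> 'S_k}) : exists2 g : 'S_N, g \in wreath &
  forall a b, g (mxvec_index a b) = mxvec_index (s a) (tau a b).
Proof.
pose h (c : 'I_N) := mxvec_index (s (slot c).1) (tau (slot c).1 (slot c).2).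
have h_inj : injective h.
  move=> c c' /(congr1 (@slot d k)); rewrite !slotK => -[/perm_inj e1].
  rewrite e1 => /perm_inj e2; rewrite -(mxvec_slotK c) -(mxvec_slotK c').
  by rewrite e1 e2.
have hE a b : perm h_inj (mxvec_index a b) = mxvec_index (s a) (tau a b).
  by rewrite permE /h slotK.
by exists (perm h_inj) => //; apply/wreathP; exists s, tau.
Qed.

Definition wreath_sym : 'End(T) := (#|wreath|%:R)^-1 *: \sum_(g in wreath) permute_factors C I g.

Lemma card_wreath_neq0 : (#|wreath|%:R : C) != 0.
Proof. by rewrite pnatr_eq0 -lt0n cardG_gt0. Qed.

Lemma wreath_sym_rho g : g \in wreath -> (permute_factors C I g \o wreath_sym = wreath_sym)%VF.
Proof.
move=> gG; rewrite /wreath_sym -comp_lfunZr comp_lfun_sumr; congr (_ *: _).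
rewrite [RHS](reindex_inj (mulIg g)) /=.
by apply: eq_big => [r|r _]; rewrite ?rhoM // groupMr.
Qed.

Lemma wreath_invariant t : (forall g, g \in wreath -> permute_factors C I g t = t) -> wreath_sym t = t.
Proof.
move=> h; rewrite scale_lfunE sum_lfunE (eq_bigr (fun=> t)) // sumr_const -scaler_nat.
by rewrite scalerA mulVf ?scale1r ?card_wreath_neq0.
Qed.

Lemma wreath_sym_idem : (wreath_sym \o wreath_sym = wreath_sym)%VF.
Proof.
apply/lfunP => t; rewrite comp_lfunE; apply: wreath_invariant => g gG.
by rewrite -comp_lfunE wreath_sym_rho.
Qed.

Lemma limg_wreath_sym t : reflect (forall g, g \in wreath -> permute_factors C I g t = t)
  (t \in limg wreath_sym).
Proof.
apply: (iffP memv_imgP) => [[v _ ->] g gG|h].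
  by rewrite -comp_lfunE wreath_sym_rho.
by exists t; rewrite ?memvf // wreath_invariant.
Qed.

Lemma regroup_wreath : (regroup d k I C @: limg wreath_sym)%VS =
  sym_power d (sym_power k {:{ffun I -> C^o}}%VS).
Proof.
apply/vspaceP => t; apply/memv_imgP/sym_sym_powerP => [[u uE ->]|[h1 h2]].
  move/limg_wreath_sym: uE => h; split=> [tau f|s f]; rewrite !regroupE.
    have [g gG gE] := wreath_perm 1 tau; rewrite -[in RHS](h g gG) rhoE; congr (u _).
    by apply/ffunP => c; case/mxvec_indexP: c => a b; rewrite !ffunE gE !slotK /= perm1.
  have [g gG gE] := wreath_perm s [ffun=> 1%g]; rewrite -[in RHS](h g gG) rhoE; congr (u _).
  by apply/ffunP => c; case/mxvec_indexP: c => a b; rewrite !ffunE gE !slotK /= ffunE perm1.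
exists [ffun w => t (split_word w)]; last first.
  by apply/ffunP => f; rewrite regroupE ffunE concat_wordK.
apply/limg_wreath_sym => g /wreathP[s [tau gE]]; apply/ffunP => w.
rewrite rhoE !ffunE -[RHS](h2 s) -[RHS](h1 tau); congr (t _).
by apply/ffunP => a; apply/ffunP => b; rewrite !ffunE gE.
Qed.

(** The idempotent to decompose is the average over the wreath product. The embeddings are
    permutation operators followed by the regrouping; equivariance holds because permuting tensor
    factors commutes with applying one map to all of them. *)
Theorem plethysm_decomposition_exists : exists mus, plethysm_decomposition C I d k mus.
Proof.
have Pe : perm_op wreath_sym.
  by apply: perm_opZ; apply: perm_op_sum => g _; exact: perm_op_rho.
have [l [l1 l2 l3]] := idempotent_decomposition Pe wreath_sym_idem.
pose mus := [seq p.1 | p <- l]; exists mus.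
have sz : size mus = size l by rewrite size_map.
pose p0 : seq nat * 'End(T) := ([::], 0).
pose phi (i : 'I_(size mus)) := (regroup d k I C \o (nth p0 l i).2)%VF.
have nthm (i : 'I_(size mus)) : nth [::] mus i = (nth p0 l i).1.
  by rewrite (nth_map p0) -?sz.
have inl (i : 'I_(size mus)) : nth p0 l i \in l by rewrite mem_nth -?sz.
have big (R : Type) (idx : R) (op : Monoid.com_law idx) (f : seq nat * 'End(T) -> R) :
    \big[op/idx]_(p <- l) f p = \big[op/idx]_(i < size mus) f (nth p0 l i).
  by rewrite (big_nth p0) big_mkord sz.
have ker0 (U : {vspace T}) : (U :&: lker (regroup d k I C))%VS = 0%VS.
  by rewrite regroup_ker capv0.
have sumE : (\sum_(i < size mus) (phi i @: schur_functor C N I (nth [::] mus i)))%VS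
    = (regroup d k I C @: limg wreath_sym)%VS.
  rewrite -l2 big limg_sum; apply: eq_bigr => i _.
  by rewrite /phi limg_comp nthm.
exists phi; split.
- by apply/allP => _ /mapP[p /l1[? _ _] ->].
- move=> i; have [_ _] := l1 _ (inl i); rewrite nthm => e.
  apply/eqP; rewrite -subv0 -e; apply/subvP => t; rewrite !memv_cap !memv_ker.
  rewrite comp_lfunE => /andP[/eqP rt ->]; rewrite andbT; apply/eqP.
  by apply: (lker0P (introT eqP (regroup_ker d k I C))); rewrite rt linear0.
- move=> i g t _ _; have [_ Px _] := l1 _ (inl i).
  by rewrite /phi !comp_lfunE (tensor_map_perm_op g t Px) regroup_tensor_map.
- rewrite directvE /= -/mus sumE limg_dim_eq // -l3 big; apply/eqP/eq_bigr => i _.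
  by rewrite nthm /phi limg_comp [RHS]limg_dim_eq.
- by rewrite sumE regroup_wreath.
Qed.

End Wreath.

(** * Two-letter weight spaces of iterated symmetric powers *)

Section BoxedPartitions.
Local Open Scope nat_scope.

(** The partitions of [j] in a d x k box, padded with zeros to length [d] and enumerated by their
    largest part [x]. *)
Fixpoint box_seqs d k j : seq (seq nat) :=
  if d is d'.+1 then [seq x :: s | x <- iota 0 (minn k j).+1, s <- box_seqs d' x (j - x)]
  else if j == 0 then [:: [::]] else [::].

Lemma box_seqsS d k j : box_seqs d.+1 k j =
  [seq x :: s | x <- iota 0 (minn k j).+1, s <- box_seqs d x (j - x)].
Proof. by []. Qed.

Lemma mem_box_seqs d k j s :
  (s \in box_seqs d k j) = [&& size s == d, sorted geq s, all (fun x => x <= k) s & sumn s == j].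
Proof.
elim: d k j s => [|d IHd] k j [|x s]; [by case: j | by case: j | |]; rewrite box_seqsS.
  by apply/negbTE; apply/negP => /allpairsPdep[? [? []]].
rewrite -[size _ == _]/(size s == d) -[sorted _ _]/(path geq x s) -[all _ _]/((x <= k) && all (leq^~ k) s).
have geq_trans : transitive geq by move=> a b c /= ab bc; exact: leq_trans bc ab.
rewrite path_sortedE //; apply/allpairsPdep/idP => [[y [u [+ + [-> ->]]]]|].
  rewrite mem_iota /= add0n ltnS leq_min IHd => /andP[yk yj] /and4P[/eqP -> -> al /eqP ->].
  rewrite eqxx subnKC // eqxx yk andbT /= andbT al /=.
  by apply: sub_all al => z /leq_trans; apply.
move=> /and4P[ss /andP[ax srt] /andP[xk al] /eqP sj]; exists x, s; split=> //.
  by rewrite mem_iota /= add0n ltnS leq_min xk -sj leq_addr.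
by rewrite IHd -sj addKn eqxx srt ax andbT ss.
Qed.

Lemma box_seqs_uniq d k j : uniq (box_seqs d k j).
Proof.
elim: d k j => [|d IHd] k j; first by case: j.
apply: allpairs_uniq_dep => [|x _|[x s] [y u] _ _ /= [-> ->]//]; first exact: iota_uniq.
exact: IHd.
Qed.

Lemma size_box_seqsS d k j :
  size (box_seqs d.+1 k j) = \sum_(x < k.+1) if x <= j then size (box_seqs d x (j - x)) else 0.
Proof.
rewrite box_seqsS size_allpairs_dep sumnE big_map -big_mkcond.
rewrite -[in RHS](big_mkord (fun x => x <= j) (fun x => size (box_seqs d x (j - x)))).
rewrite /index_iota subn0 -[in RHS]big_filter; congr bigop.
apply: (irr_sorted_eq ltn_trans ltnn); first exact: iota_ltn_sorted.
  by apply: sorted_filter; [exact: ltn_trans | exact: iota_ltn_sorted].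
by move=> x; rewrite mem_filter !mem_iota /= !add0n !ltnS leq_min andbC.
Qed.

End BoxedPartitions.

Section SymWeights.
Local Open Scope ring_scope.
Variables (C : numClosedFieldType) (d k j : nat).
Notation N := (d * k)%N.
Notation I := 'I_N.
Notation dword := (word d (word k I)).

Definition split_words : {set dword} := [set f : dword | concat_word f \in two_letter_words N j].

Definition ones (v : word k I) := #|[set b | val (v b) == 1%N]|.

(** On two-letter words this is a complete invariant for permutations of the slots and inside the
    slots, so the orbits correspond to partitions in a box. *)
Definition slot_type (f : dword) : seq nat := sort geq [seq ones (f a) | a <- enum 'I_d].

Hypothesis jN : (2 * j <= N)%N.

Lemma sum_slots (P : pred 'I_N) : #|[set c | P c]| = (\sum_a #|[set b | P (mxvec_index a b)]|)%N.
Proof.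
rewrite -sum1dep_card big_mkcond big_slot; apply: eq_bigr => a _.
by rewrite -sum1dep_card [RHS]big_mkcond.
Qed.

Lemma split_wordsP (f : dword) : f \in split_words ->
  (forall a b, (val (f a b) <= 1)%N) /\ (\sum_a ones (f a))%N = j.
Proof.
rewrite !inE => /andP[/forallP h /eqP <-]; split=> [a b|].
  by have := h (mxvec_index a b); rewrite ffunE slotK.
rewrite sum_slots; apply: eq_bigr => a _; apply: eq_card => b.
by rewrite !inE /is_one ffunE slotK.
Qed.

Lemma geq_sort_perm (s u : seq nat) : reflect (sort geq s = sort geq u) (perm_eq s u).
Proof.
apply: perm_sortP; first by move=> x y; exact: leq_total.
- by move=> a b c /= ab bc; exact: leq_trans bc ab.
- by move=> a b /=; rewrite andbC -eqn_leq => /eqP.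
Qed.

Lemma slot_type_mem f : f \in split_words -> slot_type f \in box_seqs d k j.
Proof.
move=> /split_wordsP[_ h]; rewrite mem_box_seqs; apply/and4P; split.
- by rewrite size_sort size_map size_enum_ord.
- by apply: sort_sorted => x y; exact: leq_total.
- rewrite all_sort all_map; apply/allP => a _ /=.
  by rewrite -[X in (_ <= X)%N]card_ord max_card.
- by rewrite (perm_sumn (permEl (perm_sort _ _))) sumnE big_map big_enum /= h.
Qed.

Lemma slot_type_orbit f f' : f \in split_words -> f' \in split_words -> slot_type f = slot_type f' ->
  exists (s : 'S_d) tau, f' = slotwise tau [ffun a => f (s a)].
Proof.
move=> /split_wordsP[fl _] /split_wordsP[fl' _] e.
pose u := [tuple ones (f a) | a < d]; pose u' := [tuple ones (f' a) | a < d].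
have : perm_eq u' u.
  exact/geq_sort_perm/esym.
move=> /tuple_permP[s us]; exists s.
have os a : ones (f' a) = ones (f (s a)).
  have : tnth u' a = tnth u (s a).
    have -> : u' = [tuple tnth u (s i) | i < d] by apply/val_inj.
    by rewrite tnth_mktuple.
  by rewrite !tnth_mktuple.
have ex a : exists r : 'S_k, [forall b, f' a b == f (s a) (r b)].
  pose v := [tuple f (s a) b | b < k]; pose v' := [tuple f' a b | b < k].
  have : perm_eq v' v.
    (* With only two letters present, the number of ones determines the multiset of letters of a
       slot. *)
    have cnt (h : word k I) n : (forall b, (val (h b) <= 1)%N) ->
        count (fun x : I => val x == n) [tuple h b | b < k] =
        (if n == 1 then ones h else if n == 0 then k - ones h else 0)%N.
      move=> hl; rewrite count_map -size_filter -sum1_size big_filter big_enum_cond /=.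
      rewrite sum1dep_card; case: eqP => [->//|/eqP n1]; case: eqP => [->|/eqP n0].
        rewrite -[in RHS](card_ord k) -(cardC [set b | val (h b) == 1%N]) addKn.
        apply: eq_card => b; rewrite !inE.
        by move: (hl b) => /=; case: (h b : nat) => [|[|]].
      apply/eqP; rewrite cards_eq0; apply/eqP/setP => b; rewrite !inE.
      by move: (hl b) n1 n0 => /=; case: n => [|[|n]] //; case: (h b : nat) => [|[|]].
    apply/allP => x _ /=; apply/eqP.
    have := cnt (f' a) (val x) (fl' a); have := cnt (f (s a)) (val x) (fl (s a)).
    by rewrite os => <- ->.
  move=> /tuple_permP[r vr]; exists r; apply/forallP => b; apply/eqP.
  have : tnth v' b = tnth v (r b).
    have -> : v' = [tuple tnth v (r i) | i < k] by apply/val_inj.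
    by rewrite tnth_mktuple.
  by rewrite !tnth_mktuple.
have [r rP] := fin_all_exists ex; exists (finfun r).
apply/ffunP => a; apply/ffunP => b; rewrite !ffunE.
by move/forallP/(_ b)/eqP: (rP a).
Qed.

Lemma concat_slotwise (s : 'S_d) tau (f : dword) : exists g : 'S_N,
  concat_word (slotwise tau [ffun a => f (s a)]) = permute_word g (concat_word f).
Proof.
have [g _ gE] := wreath_perm s tau; exists g.
by apply/ffunP => c; case/mxvec_indexP: c => a b; rewrite !ffunE gE !slotK.
Qed.

Lemma split_words_slotwise (s : 'S_d) tau f : f \in split_words -> slotwise tau [ffun a => f (s a)] \in split_words.
Proof.
rewrite !inE; have [g ->] := concat_slotwise s tau f => fA.
by have := @permute_two_letter N g j (concat_word f); rewrite !inE; apply.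
Qed.

Lemma slot_type_slotwise (s : 'S_d) tau (f : dword) : slot_type (slotwise tau [ffun a => f (s a)]) = slot_type f.
Proof.
apply/geq_sort_perm.
have e a : ones (slotwise tau [ffun a => f (s a)] a) = ones (f (s a)).
  rewrite /ones -(card_imset _ (@perm_inj _ (tau a))); apply: eq_card => b; rewrite !inE.
  apply/imsetP/idP => [[b' + ->]|h]; first by rewrite inE !ffunE.
  exists ((tau a)^-1 b)%g; last by rewrite permKV.
  by rewrite inE !ffunE permKV.
rewrite (eq_map e) (map_comp (fun a => ones (f a)) s); apply: perm_map.
apply: uniq_perm; [by rewrite (map_inj_uniq (@perm_inj _ s)) enum_uniq | exact: enum_uniq |].
move=> a; rewrite [RHS]mem_enum; apply/mapP; exists (s^-1 a)%g; last by rewrite permKV.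
by rewrite mem_enum.
Qed.

Lemma slot_type_exists u : u \in box_seqs d k j -> exists2 f, f \in split_words & slot_type f = u.
Proof.
rewrite mem_box_seqs => /and4P[/eqP ud us /allP uk /eqP uj].
pose P (c : 'I_N) := ((slot c).2 < nth 0 u (slot c).1)%N.
have uka (a : 'I_d) : (nth 0 u a <= k)%N by apply: uk; rewrite mem_nth ?ud.
have card_lt n : (n <= k)%N -> #|[set b : 'I_k | (b < n)%N]| = n.
  by move=> nk; rewrite -sum1dep_card (big_ord_narrow nk) sum1_card card_ord.
have PE (a : 'I_d) : #|[set b | P (mxvec_index a b)]| = nth 0%N u a.
  rewrite -[RHS]card_lt ?uka //; apply: eq_card => b; rewrite !inE /P slotK //.
have cP : #|[set c | P c]| = j.
  rewrite sum_slots (eq_bigr _ (fun a _ => PE a)) -uj sumnE (big_nth 0%N) ud.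
  by rewrite big_mkord.
have [w wA ow] := two_letter_exists cP jN.
exists (split_word w); first by rewrite inE split_wordK.
have e a : ones (split_word w a) = nth 0%N u a.
  by rewrite -PE; apply: eq_card => b; rewrite !inE !ffunE -[RHS]ow.
rewrite /slot_type (eq_map e) (map_comp (nth 0%N u) val) val_enum_ord.
rewrite -[X in iota 0 X]ud -/(mkseq _ _) mkseq_nth; apply: sorted_sort => //.
by move=> a b c /= ab bc; exact: leq_trans bc ab.
Qed.

(** An invariant function is constant on orbits, so the indicator functions [b i] of the orbits form
    a basis of the weight space; [h i] is a word of the i-th orbit. *)
Lemma sym_weight_dim :
  \dim (sym_power d (sym_power k {:{ffun I -> C^o}}%VS) :&: supp_space C split_words) =
  size (box_seqs d k j).
Proof.
pose L := box_seqs d k j; pose n := size L.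
pose b (i : 'I_n) : {ffun dword -> C^o} :=
  [ffun f => ((f \in split_words) && (slot_type f == nth [::] L i))%:R].
pose X := [tuple b i | i < n].
have Xi (i : 'I_n) : X`_i = b i by rewrite -tnth_nth tnth_mktuple.
have ex (i : 'I_n) : exists f, (f \in split_words) && (slot_type f == nth [::] L i).
  have [|f fA <-] := @slot_type_exists (nth [::] L i); first by rewrite mem_nth.
  by exists f; rewrite fA eqxx.
have [h hP] := fin_all_exists ex.
have bh (i i' : 'I_n) : b i (h i') = (i == i')%:R.
  rewrite ffunE; case/andP: (hP i') => -> /eqP ->; rewrite nth_uniq ?box_seqs_uniq //.
  by rewrite eq_sym.
have freeX : free X.
  apply/freeP => c e i; have := congr1 (fun t : {ffun dword -> C^o} => t (h i)) e.
  rewrite /= sum_ffunE ffunE (bigD1 i) //= big1 ?addr0 => [|i' ne].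
    by rewrite ffunE Xi bh eqxx [_ *: _]mulr1.
  by rewrite ffunE Xi bh (negPf ne) scaler0.
suff -> : (sym_power d (sym_power k {:{ffun I -> C^o}}%VS) :&: supp_space C split_words)%VS = <<X>>%VS.
  by move: freeX; rewrite /free size_tuple => /eqP.
apply/eqP; rewrite eqEsubv; apply/andP; split; last first.
  apply/span_subvP => _ /mapP[i _ ->]; rewrite memv_cap; apply/andP; split.
    apply/sym_sym_powerP; split=> [tau f|s f]; rewrite !ffunE.
      have e : slotwise tau f = slotwise tau [ffun a => f ((1%g : 'S_d) a)].
        by congr slotwise; apply/ffunP => a; rewrite ffunE perm1.
      rewrite e slot_type_slotwise; congr (_ && _)%:R; apply/idP/idP; last exact: split_words_slotwise.
      move=> fA; have := split_words_slotwise 1%g [ffun a => (tau a)^-1%g] fA.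
      suff -> : slotwise [ffun a => (tau a)^-1%g]
          [ffun a => slotwise tau [ffun a => f ((1%g : 'S_d) a)] ((1%g : 'S_d) a)] = f by [].
      by apply/ffunP => a; apply/ffunP => c; rewrite !ffunE !perm1 permKV.
    have e : [ffun a => f (s a)] = slotwise [ffun=> 1%g] [ffun a => f (s a)].
      by apply/ffunP => a; apply/ffunP => c; rewrite !ffunE perm1.
    rewrite e slot_type_slotwise; congr (_ && _)%:R; apply/idP/idP; last exact: split_words_slotwise.
    move=> fA; have := split_words_slotwise s^-1%g [ffun=> 1%g] fA.
    suff -> : slotwise [ffun=> 1%g : 'S_k]
        [ffun a => slotwise [ffun=> 1%g] [ffun a => f (s a)] ((s^-1)%g a)] = f by [].
    by apply/ffunP => a; apply/ffunP => c; rewrite !ffunE !perm1 permKV.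
  by apply/supp_spaceP => f /negPf fA; rewrite ffunE fA.
apply/subvP => t; rewrite memv_cap => /andP[/sym_sym_powerP[t1 t2] /supp_spaceP tA].
have -> : t = \sum_(i < n) (t (h i) : C) *: b i.
  apply/ffunP => f; rewrite sum_ffunE.
  have [fA|fA] := boolP (f \in split_words); last first.
    by rewrite tA // big1 // => i _; rewrite !ffunE (negPf fA) scaler0.
  have lt : (index (slot_type f) L < n)%N by rewrite index_mem slot_type_mem.
  rewrite (bigD1 (Ordinal lt)) //= big1 ?addr0 => [|i ne].
    rewrite !ffunE fA nth_index ?slot_type_mem // eqxx [_ *: _]mulr1.
    case/andP: (hP (Ordinal lt)) => hA /eqP; rewrite nth_index ?slot_type_mem // => ty.
    have [s [tau fE]] := slot_type_orbit hA fA ty.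
    by rewrite [in LHS]fE t1 t2.
  rewrite !ffunE fA (_ : (_ == _) = false) ?scaler0 //.
  apply: contraNF ne => /eqP e; apply/eqP/val_inj => /=.
  by rewrite e index_uniq ?box_seqs_uniq.
apply: rpred_sum => i _; apply/memvZ/memv_span; rewrite -Xi mem_nth ?size_tuple //.
Qed.

End SymWeights.

(** * Multiplicities of two-row partitions *)

Section Diagonal.
Local Open Scope ring_scope.
Variable F : fieldType.

Definition diagonal (I : finType) (m : I -> F) (g : 'End({ffun I -> F^o})) :=
  forall t i, g t i = m i * t i.

Lemma tensor_map_diagonal (I : finType) (m : I -> F) g k : diagonal m g ->
  diagonal (fun w : word k I => \prod_a m (w a)) (tensor_map k g).
Proof.
move=> dg t w; rewrite tensor_mapE (bigD1 w) //= [X in _ + X]big1 ?addr0 => [|f ne].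
  rewrite mulrC; congr (_ * _); apply: eq_bigr => a _.
  by rewrite dg ffunE eqxx mulr1.
have [a ne_a] : exists a, f a != w a.
  apply/existsP; apply: contraNT ne; rewrite negb_exists => /forallP z.
  by apply/eqP/ffunP => a; apply/eqP; have := z a; rewrite negbK.
by rewrite (bigD1 a) //= dg ffunE eq_sym (negPf ne_a) mulr0 mul0r mulr0.
Qed.

Lemma diagonal_eigenP (I : finType) (m : I -> F) g (la : F) (t : {ffun I -> F^o}) : diagonal m g ->
  reflect (g t = la *: t) (t \in supp_space F [set i | m i == la]).
Proof.
move=> dg; apply: (iffP (supp_spaceP _ _)) => [z|e i].
  apply/ffunP => i; rewrite dg ffunE; have [->//|ne] := eqVneq (m i) la.
  by rewrite z ?inE // mulr0 scaler0.
rewrite inE => ne; have := congr1 (fun u : {ffun I -> F^o} => u i) e.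
rewrite /= dg ffunE => /eqP; rewrite -subr_eq0 -[la *: _]/(la * _) -mulrBl mulf_eq0 subr_eq0.
by rewrite (negPf ne) => /eqP.
Qed.

Definition diag_fun (I : finType) (m : I -> F) (t : {ffun I -> F^o}) : {ffun I -> F^o} :=
  [ffun i => m i * t i].

Fact diag_fun_is_linear I m : linear (@diag_fun I m).
Proof. by move=> c t u; apply/ffunP => i; rewrite !ffunE mulrDr [in LHS]mulrCA. Qed.
HB.instance Definition _ I m := GRing.isLinear.Build F _ _ _ (@diag_fun I m) (@diag_fun_is_linear I m).

Lemma diag_diagonal (I : finType) (m : I -> F) : diagonal m (linfun (diag_fun m)).
Proof. by move=> t i; rewrite lfunE ffunE. Qed.

End Diagonal.

Section Multiplicity.
Local Open Scope ring_scope.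
Variables (C : numClosedFieldType) (d k j : nat).
Notation N := (d * k)%N.
Notation I := 'I_N.
Hypothesis jN : (2 * j <= N)%N.

(* Eigenvalue 2^j of diag(1, 2, 3, 3, ...) on a tensor power singles out the
   words in two letters. *)
Definition letter_weight (i : I) : nat :=
  if val i == 0%N then 1%N else if val i == 1%N then 2%N else 3%N.

(** Any third letter contributes a factor 3, which does not divide a power of 2; otherwise the
    exponent of 2 counts the ones. *)
Lemma two_letter_weight (w : word N I) :
  (\prod_a letter_weight (w a) == 2 ^ j)%N = (w \in two_letter_words N j).
Proof.
rewrite inE; have [/forallP h|/existsP[a wa]] := boolP [forall a, (val (w a) <= 1)%N].
  have -> : (\prod_a letter_weight (w a) = 2 ^ #|[set a | is_one w a]|)%N.
    rewrite (eq_bigr (fun a => if is_one w a then 2 else 1)%N) => [|a _].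
      by rewrite -big_mkcond prod_nat_const cardsE.
    by have := h a; rewrite /letter_weight /is_one; case: (val (w a)) => [|[|]].
  by rewrite eqn_exp2l.
rewrite /=; apply/negbTE/eqP => e; have : (3 %| 2 ^ j)%N.
  rewrite -e (bigD1 a) //= dvdn_mulr // /letter_weight.
  by move: wa; rewrite -ltnNge; case: (val (w a)) => [|[|]].
by rewrite Euclid_dvdX.
Qed.

Let g : 'End({ffun I -> C^o}) := linfun (diag_fun (fun i => (letter_weight i)%:R)).

Let g_diag : diagonal (fun i => (letter_weight i)%:R) g.
Proof. exact: diag_diagonal. Qed.

Let g_inj : lker g == 0%VS.
Proof.
apply/lker0P => t u e; apply/ffunP => i; apply: (mulfI (x := (letter_weight i)%:R)).
  by rewrite pnatr_eq0 /letter_weight; case: ifP => // _; case: ifP.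
by rewrite -(g_diag t) -(g_diag u) e.
Qed.

Let eigen_words t : reflect (tensor_map N g t = (2 ^ j)%:R *: t)
  (t \in supp_space C (two_letter_words N j)).
Proof.
have := diagonal_eigenP (2 ^ j)%:R t (tensor_map_diagonal (k := N) g_diag).
congr (reflect _ (_ \in supp_space C _)); apply/setP => w; rewrite [LHS]finset.in_set -two_letter_weight.
by rewrite -natr_prod eqr_nat.
Qed.

Let eigen_split t : reflect (tensor_map d (tensor_map k g) t = (2 ^ j)%:R *: t)
  (t \in supp_space C (split_words d k j)).
Proof.
have := diagonal_eigenP (2 ^ j)%:R t (tensor_map_diagonal (k := d) (tensor_map_diagonal (k := k) g_diag)).
congr (reflect _ (_ \in supp_space C _)); apply/setP => f; rewrite [LHS]finset.in_set [RHS]finset.in_set.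
rewrite -[RHS]/(concat_word f \in two_letter_words N j) -two_letter_weight.
rewrite -(eqr_nat C) natr_prod big_slot; congr (_ == _); apply: eq_bigr => a _.
by apply: eq_bigr => b _; rewrite ffunE slotK.
Qed.

(** Both sides are the dimension of the 2^j-eigenspace of the action of [g]. The summands are stable
    and independent, so this eigenspace is the direct sum of theirs; the equivariant embeddings
    identify these with weight spaces of Schur functors, of dimension 0 or 1. *)
Lemma decomposition_count mus : plethysm_decomposition C I d k mus ->
  count (fun mu => (size mu <= 2)%N && (nth 0%N mu 1 <= j)%N) mus = size (box_seqs d k j).
Proof.
case=> phi [/allP mus_part phi_inj phi_eq dir sumE]; rewrite -(sym_weight_dim C jN) -sumE.
set S_ := fun i : 'I_(size mus) => schur_functor C N I (nth [::] mus i).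
pose V i := (phi i @: S_ i)%VS; pose E' := supp_space C (split_words d k j).
pose E := supp_space C (two_letter_words N j).
have S_stable i t : t \in S_ i -> tensor_map N g t \in S_ i.
  case/memv_imgP => u _ ->; rewrite -(tensor_map_perm_op g u (@young_op C N I _)).
  by rewrite memv_img ?memvf.
have V_stable i v : v \in V i -> tensor_map d (tensor_map k g) v \in V i.
  by case/memv_imgP => t tS ->; rewrite -phi_eq // memv_img // S_stable.
have indep : forall u, (forall i, xpredT i -> u i \in V i) ->
    \sum_(i < size mus) u i = 0 -> forall i, xpredT i -> u i = 0.
  exact/directv_sum_independent.
have capE : ((\sum_i V i) :&: E' = \sum_i (V i :&: E'))%VS.
  apply/eqP; rewrite eqEsubv; apply/andP; split; last first.
    apply/subv_sumP => i _; rewrite subv_cap capvSr andbT.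
    by apply: subv_trans (capvSl _ _) _; rewrite (sumv_sup i).
  apply/subvP => v; rewrite memv_cap => /andP[/memv_sumP[u uV ->] /eigen_split e].
  apply: memv_sumr => i _; rewrite memv_cap uV //=; apply/eigen_split.
  apply/eqP; rewrite -subr_eq0; apply/eqP.
  apply: (indep (fun i => tensor_map d (tensor_map k g) (u i) - (2 ^ j)%:R *: u i)) => //.
    by move=> i' _; rewrite rpredB ?memvZ ?V_stable ?uV.
  by rewrite sumrB -scaler_sumr -e linear_sum subrr.
have dir' : directv (\sum_i (V i :&: E')).
  apply/directv_sum_independent => u uV; apply: indep => i _.
  by have := uV i isT; rewrite memv_cap => /andP[].
have dimE i : \dim (V i :&: E') = \dim (S_ i :&: E).
  have -> : (V i :&: E' = phi i @: (S_ i :&: E))%VS.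
    apply/eqP; rewrite eqEsubv; apply/andP; split; apply/subvP => v.
      rewrite memv_cap => /andP[/memv_imgP[t tS ->] /eigen_split e].
      apply: memv_img; rewrite memv_cap tS; apply/eigen_words/eqP.
      rewrite -subr_eq0 -memv0 -(phi_inj i) memv_cap memv_ker linearB /= phi_eq // e linearZ subrr eqxx /=.
      by rewrite rpredB ?memvZ ?S_stable.
    case/memv_imgP => t tSE ->; move: tSE; rewrite !memv_cap => /andP[tS /eigen_words e].
    rewrite memv_img //=; apply/eigen_split.
    by rewrite -phi_eq // e linearZ.
  apply: limg_dim_eq; apply/eqP; rewrite -subv0 -(phi_inj i) subv_cap capvSr /=.
  by apply: subv_trans (capvSl _ _) (capvSl _ _).
rewrite -/E' capE (directvP dir') /=.
rewrite (eq_bigr _ (fun i _ => dimE i)) -sum1_count big_mkcond (big_nth [::]) big_mkord.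
apply: eq_bigr => i _; rewrite schur_weight_dim //; last by apply: mus_part; rewrite mem_nth.
Qed.

End Multiplicity.

(** Zeros are dropped to meet the convention of positive parts when [j] or [N] is 0; the value at s
    = 0 depends on it. *)
Definition two_row (N j : nat) : seq nat := [seq x <- [:: (N - j)%N; j] | x != 0%N].

Lemma two_row_partition N j : (2 * j <= N)%N -> is_partition_of N (two_row N j).
Proof.
move=> jN; rewrite /two_row /is_partition_of /=.
case: (eqVneq (N - j)%N 0%N) => [e|n1]; case: (eqVneq j 0%N) => [e'|n2] /=; rewrite ?inE; lia.
Qed.

Lemma two_row_eq N j mu : (2 * j <= N)%N -> is_partition_of N mu ->
  (mu == two_row N j) = (size mu <= 2)%N && (nth 0%N mu 1 == j).
Proof.
move=> jN Pmu; apply/eqP/andP => [->|[s2 /eqP e]].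
  by rewrite /two_row /=; case: (eqVneq (N - j)%N 0%N) => [e|n1]; case: (eqVneq j 0%N) => [e'|n2] /=; lia.
have /and3P[_ _ /eqP sN] := Pmu.
apply: (partition_eq Pmu (two_row_partition jN)) => i.
rewrite /two_row /=; move: s2 e sN jN; case: mu {Pmu} => [|a [|b [|]]] //= _ <- sN jN.
- by rewrite -sN /= nth_nil.
- by rewrite -sN addn0 subn0 /=; case: eqP => [->|]; case: i => [|[]].
- rewrite /= addn0 in sN; have -> : (N - b = a)%N by lia.
  case: (eqVneq a 0%N) => [a0|a0]; case: (eqVneq b 0%N) => [b0|b0] /=; case: i => [|[|i]] //=; rewrite ?nth_nil; lia.
Qed.

(** Whichever decomposition [xget] selects, the shapes with at most two rows and second part exactly
    [j] are those with second part at most [j], less those with second part at most [j - 1]. *)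
Lemma plethysm_coeff_two_row (R : realType) d k j : (2 * j <= d * k)%N ->
  plethysm_coeff R d k (two_row (d * k) j) =
  (size (box_seqs d k j) - (if j is j'.+1 then size (box_seqs d k j') else 0))%N.
Proof.
move=> jN; rewrite /plethysm_coeff.
have [mus0 dec0] := @plethysm_decomposition_exists R[i] d k.
case: xgetP => [m _ [mus [dec ->]]|/(_ (count_mem (two_row (d * k) j) mus0)) []]; last by exists mus0.
have mus_part mu : mu \in mus -> is_partition_of (d * k) mu.
  by case: dec => phi [/allP + _ _ _ _]; apply.
rewrite -(decomposition_count jN dec); case: j jN => [|j'] jN.
  rewrite subn0; apply: eq_in_count => mu /mus_part Pmu /=.
  by rewrite (two_row_eq jN Pmu) leqn0.
have jN' : (2 * j' <= d * k)%N by lia.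
rewrite -(decomposition_count jN' dec).
set a := fun mu => _; set b := fun mu => _ && (_ <= j')%N.
have := count_predUI (pred1 (two_row (d * k) j'.+1)) b mus.
have -> : count (predU (pred1 (two_row (d * k) j'.+1)) b) mus = count a mus.
  apply: eq_in_count => mu /mus_part Pmu /=.
  rewrite (two_row_eq jN Pmu) /a /b; case: (size mu <= 2)%N => //=.
  by rewrite [in RHS]leq_eqVlt.
have -> : count (predI (pred1 (two_row (d * k) j'.+1)) b) mus = 0%N.
  apply/eqP; rewrite -leqn0 leqNgt -has_count; apply/hasPn => mu /mus_part Pmu /=.
  rewrite (two_row_eq jN Pmu) /b; apply/negP => /andP[/andP[_ /eqP ->] /andP[_]].
  by rewrite ltnn.
by rewrite addn0 => ->; rewrite addnK.
Qed.

(** * Lattice points of dilated convex bodies *)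

Section ArgMax.
Local Open Scope ring_scope.

Lemma seq_argmax (R : realDomainType) (T : eqType) (f : T -> R) (s : seq T) :
  s != [::] -> exists2 x, x \in s & {in s, forall y, f y <= f x}.
Proof.
elim: s => // a s IHs _; have [->|/IHs[x xs xmax]] := eqVneq s [::].
  by exists a; rewrite ?mem_head // => y; rewrite inE => /eqP->.
have [le|lt] := leP (f a) (f x).
  by exists x; rewrite ?inE ?xs ?orbT // => y; rewrite inE => /orP[/eqP->|/xmax].
exists a; rewrite ?mem_head // => y; rewrite inE => /orP[/eqP->//|/xmax h].
exact: le_trans h (ltW lt).
Qed.

End ArgMax.

Section SeparatingFunctional.
Local Open Scope ring_scope.
Variables (R : realFieldType) (m : nat).

(** Vectors are read as polynomials and evaluated at a natural number. The product [p] of the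
    nonzero differences has finitely many roots, so some natural number avoids them all. *)
Lemma separating_functional (s : seq 'rV[R]_m) :
  exists l : 'rV[R]_m -> R, (forall a u v, l (a *: u + v) = a * l u + l v) /\ {in s &, injective l}.
Proof.
pose p := \prod_(u <- s) \prod_(v <- s | u != v) rVpoly (u - v).
have p0 : p != 0.
  rewrite prodf_seq_neq0; apply/allP => u _ /=; rewrite prodf_seq_neq0; apply/allP => v _.
  apply/implyP => ne; apply: contraNneq ne => e; rewrite -subr_eq0.
  by rewrite -[u - v]rVpolyK e linear0.
have [i ip] : exists i : nat, ~~ root p i%:R.
  pose rs := [seq i%:R : R | i <- iota 0 (size p)].
  have urs : uniq rs.
    by rewrite map_inj_uniq ?iota_uniq // => i j /eqP; rewrite eqr_nat => /eqP.
  have : ~~ all (root p) rs.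
    apply: contraTN (leqnn (size p)) => h; rewrite -ltnNge.
    by have := max_poly_roots p0 h urs; rewrite size_map size_iota.
  by rewrite -has_predC => /hasP[_ /mapP[i _ ->] h]; exists i.
exists (fun v => (rVpoly v).[i%:R]); split=> [a u v|u v us vs e].
  by rewrite linearP hornerD hornerZ.
apply/eqP; apply: contraNT ip => ne; rewrite /root /p horner_prod.
rewrite (big_rem u) //= horner_prod (big_rem v) //= ne linearB hornerD hornerN e subrr.
by rewrite !mul0r.
Qed.

End SeparatingFunctional.

Section ConvexBody.
Import numFieldNormedType.Exports.
Local Open Scope classical_set_scope.
Local Open Scope ring_scope.
Variables (R : realType) (m : nat) (K : set 'rV[R]_m).
Hypotheses (cK : compact K) (vK : convex_set (K : set (convex_lmodType 'rV[R]_m))).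

Let conv2 x y (t : R) : K x -> K y -> 0 <= t -> t <= 1 -> K (t *: x + (1 - t) *: y).
Proof.
move=> Kx Ky t0 t1; have it : 0 <= t <= 1 by rewrite t0 t1.
have := @vK x y (Itv01 t0 t1); rewrite !inE => /(_ Kx Ky).
by [].
Qed.

Let conv3 x y z (a b c : R) : K x -> K y -> K z -> 0 <= a -> 0 <= b -> 0 <= c -> a + b + c = 1 ->
  K (a *: x + b *: y + c *: z).
Proof.
move=> Kx Ky Kz a0 b0 c0 s1; have [ab0|abn0] := eqVneq (a + b) 0.
  have -> : a = 0 by lra.
  have -> : b = 0 by lra.
  have -> : c = 1 by lra.
  by rewrite !scale0r !add0r scale1r.
have ab_gt0 : 0 < a + b by rewrite lt_neqAle eq_sym abn0 addr_ge0.
have Kxy : K ((a / (a + b)) *: x + (1 - a / (a + b)) *: y).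
  apply: conv2 => //; first exact: divr_ge0 (ltW ab_gt0).
  by rewrite ler_pdivrMr // mul1r lerDl.
have := conv2 (t := a + b) Kxy Kz; rewrite (_ : 1 - (a + b) = c); last by lra.
move=> /(_ (ltW ab_gt0)) h; have {h} := h _; rewrite (_ : (a + b) *: _ = a *: x + b *: y).
  by apply; lra.
by apply/rowP => i; rewrite !mxE; field.
Qed.

Definition lattice_set s : set 'rV[R]_m := dilate s K `&` @integer_points R m.

Lemma lattice_set_finite s : finite_set (lattice_set s).
Proof.
have [M [Mreal /(_ (M + 1))]] := compact_bounded cK.
rewrite ltrDl ltr01 => /(_ isT) bM.
have [B BM] : exists B : nat, s%:R * (M + 1) <= B%:R.
  exists (Num.bound `|s%:R * (M + 1)|).
  by apply: le_trans (ler_norm _) (ltW (archi_boundP (normr_ge0 _))).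
pose h (f : {ffun 'I_m -> 'I_(B + B).+1}) : 'rV[R]_m := \row_j ((f j)%:R - B%:R).
apply: (@sub_finite_set _ _ [set h f | f in setT]); last first.
  by apply: finite_image; exact: finite_finset.
move=> _ [[x Kx <-] xint].
have ex j : exists i : 'I_(B + B).+1, (s%:R *: x) ord0 j = i%:R - B%:R.
  have /intrP[z zE] := xint j.
  have : `|(s%:R *: x) ord0 j| <= B%:R.
    apply: le_trans BM; rewrite mxE normrM normr_nat ler_wpM2l //.
    have := bM x Kx; rewrite /= => /(le_trans _); apply.
    by rewrite [leRHS]mx_normrE; exact: (le_bigmax _ (fun i => `|x i.1 i.2|) (ord0, j)).
  rewrite zE -[B%:R]/((Posz B)%:~R) -intr_norm ler_int => zB.
  have lt : (absz (z + Posz B)%R < (B + B).+1)%N by lia.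
  exists (Ordinal lt); rewrite /=.
  have e : z = (Posz (absz (z + Posz B)%R) - Posz B)%R by lia.
  by rewrite {1}e rmorphB.
have [f fP] := fin_all_exists ex; exists (finfun f) => //.
by apply/rowP => j; rewrite mxE ffunE -fP.
Qed.

Lemma lattice_countE s : lattice_count K s = size (fset_set (lattice_set s)).
Proof. by []. Qed.

Lemma mem_lattice s v : (0 < s)%N ->
  reflect (K (s%:R^-1 *: v) /\ forall i, v ord0 i \is a Num.int) (v \in fset_set (lattice_set s)).
Proof.
move=> s0; have sn0 : s%:R != 0 :> R by rewrite pnatr_eq0 -lt0n.
rewrite in_fset_set; last exact: lattice_set_finite.
apply: (iffP idP) => [/set_mem[[x Kx <-] xi]|[Kv vi]].
  by split=> //; rewrite scalerA mulVf // scale1r.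
apply/mem_set; split=> //; exists (s%:R^-1 *: v) => //.
by rewrite scalerA mulfV // scale1r.
Qed.

(** This makes six times the count at 0 equal to the number of overlaps among the seven translates,
    and to 0 for an empty body. *)
Lemma lattice_count0 : lattice_count K 0 = `[< K !=set0 >] :> nat.
Proof.
rewrite /lattice_count; case: (pselect (K !=set0)) => [K0|K0].
  rewrite (_ : _ `&` _ = [set 0]) ?fset_set1 ?cardfs1; first by rewrite asboolT.
  apply/seteqP; split=> [v [[x _ <-] _]|v ->]; rewrite ?scale0r //=.
  case: K0 => x Kx; split; first by exists x; rewrite ?scale0r.
  by move=> i; rewrite mxE.
rewrite (_ : _ `&` _ = set0) ?fset_set0 ?cardfs0; first by rewrite asboolF.
by apply/seteqP; split=> // v [[x Kx _] _]; case: K0; exists x.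
Qed.

Local Notation Z s := (fset_set (lattice_set s)).

Section Chain.
Variables (l : 'rV[R]_m -> R) (x y : 'rV[R]_m).
Hypothesis l_lin : forall a u v, l (a *: u + v) = a * l u + l v.
Hypothesis l_inj : {in Z 6 &, injective l}.
Hypotheses (xZ : x \in Z 6) (yZ : y \in Z 6).
Hypotheses (xmin : {in Z 6, forall v, l x <= l v}) (ymax : {in Z 6, forall v, l v <= l y}).

Let lD u v : l (u + v) = l u + l v.
Proof. by rewrite -{1}(scale1r u) l_lin mul1r. Qed.

Let l0 : l 0 = 0.
Proof. by have := lD 0 0; rewrite addr0 => /eqP; rewrite addrC -subr_eq subrr eq_sym => /eqP. Qed.

Let lZ a u : l (a *: u) = a * l u.
Proof. by rewrite -[a *: u]addr0 l_lin l0 addr0. Qed.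

Let lB u v : l (u - v) = l u - l v.
Proof. by rewrite lD -scaleN1r lZ mulN1r. Qed.

Let Zn : (Z 6 : seq _) != [::].
Proof. by apply: contraTneq xZ => e; rewrite -[_ \in _]/(x \in (Z 6 : seq _)) e. Qed.

Let Z6_gt0 : (0 < size (Z 6))%N.
Proof. by rewrite lt0n size_eq0. Qed.

Definition chain_point (i : nat) (a : 'rV[R]_m) := a + i%:R *: y + (6 - i%:R) *: x.

(** Since [chain_point i y = chain_point i.+1 x], removing [y] from every translate and restoring
    only the last such point lists the union without repetition. *)
Definition chain := chain_point 6 y :: [seq chain_point i a | i <- iota 0 7, a <- rem y (Z 6)].

Let l_chain i a : l (chain_point i a) = (l a - l x) + i%:R * (l y - l x) + 7 * l x.
Proof. by rewrite /chain_point !lD !lZ; ring. Qed.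

(** Up to a common shift, [l] maps the i-th translate without its point from [y] into the half-open
    interval from i(l y - l x) to (i+1)(l y - l x). The right end is excluded because [l] is
    injective on [Z 6]; hence different translates stay apart. *)
Lemma chain_uniq : uniq chain.
Proof.
have step a : a \in rem y (Z 6) -> 0 <= l a - l x < l y - l x.
  rewrite mem_rem_uniq ?fset_uniq // inE => /andP[ne aZ].
  rewrite subr_ge0 xmin //= ltrD2r lt_neqAle ymax // andbT.
  by apply: contraNneq ne => e; apply/eqP; exact: l_inj.
have lt i a i' a' : a \in rem y (Z 6) -> 0 <= l a' - l x -> (i < i')%N ->
    chain_point i a <> chain_point i' a'.
  move=> /step/andP[a0 a1] a'0 ii' /(congr1 l); rewrite !l_chain.
  have : i%:R + 1 <= i'%:R :> R by rewrite natr1 ler_nat.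
  nra.
rewrite /chain cons_uniq; apply/andP; split.
  apply/negP => /allpairsP[[i a] [+ aZ e]]; rewrite mem_iota add0n => /= i7.
  have [i6|i6] := ltnP i 6.
    by apply: (lt _ _ _ _ aZ _ i6 (esym e)); rewrite subr_ge0 ymax.
  have ei : i = 6%N by lia.
  have /andP[_] := step a aZ; move: e; rewrite ei /chain_point /= => /addIr/addIr <-.
  by rewrite ltxx.
apply: allpairs_uniq; [exact: iota_uniq | by rewrite rem_uniq ?fset_uniq |].
move=> [i a] [i' a'] /allpairsP[[j b] [_ bZ [-> ->]]] /allpairsP[[j' b'] [_ bZ' [-> ->]]] /= e.
have [b0 b0'] : 0 <= l b - l x /\ 0 <= l b' - l x by split; [case/andP: (step _ bZ) | case/andP: (step _ bZ')].
have [ij|ij|ej] := ltngtP j j'.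
- by case: (lt _ _ _ _ bZ b0' ij e).
- by case: (lt _ _ _ _ bZ' b0 ij (esym e)).
by move: e; rewrite ej => /addIr/addIr ->.
Qed.

Lemma chain_sub : {subset chain <= Z 42}.
Proof.
have mem i a : (i <= 6)%N -> a \in Z 6 -> chain_point i a \in Z 42.
  move=> i6 aZ; apply/mem_lattice => //.
  have /mem_lattice[//|Ka ai] := aZ; have /mem_lattice[//|Kx xi] := xZ; have /mem_lattice[//|Ky yi] := yZ.
  have i6r : i%:R <= 6%:R :> R by rewrite ler_nat.
  split=> [|j]; last first.
    by rewrite !mxE !rpredD ?rpredM ?rpredB ?rpred_nat.
  have i0 : 0 <= i%:R :> R by rewrite ler0n.
  (* A chain point is a sum of seven points of 6K; dividing by 42 gives a mean of seven points of K,
     namely a/6, [i] times y/6 and [6 - i] times x/6. *)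
  have := @conv3 _ _ _ 7^-1 (i%:R / 7) ((6 - i%:R) / 7) Ka Ky Kx.
  rewrite (_ : _ + _ + _ = 42%:R^-1 *: chain_point i a).
    by apply; lra.
  by apply/rowP => j; rewrite !mxE; field.
move=> v; rewrite inE => /orP[/eqP ->|]; first exact: mem.
case/allpairsP => -[i a] [+ aZ ->]; rewrite mem_iota add0n => /= i7; apply: mem => //.
exact: mem_rem aZ.
Qed.

Lemma size_chain : size chain = (7 * (size (Z 6)).-1).+1.
Proof. by rewrite /chain -[size (_ :: _)]/((size _).+1) size_allpairs size_iota size_rem. Qed.

Lemma chain_bound : (7 * size (Z 6) <= size (Z 42) + 6)%N.
Proof.
have h : (size chain <= size (Z 42))%N := uniq_leq_size chain_uniq chain_sub.
by move: h Z6_gt0; rewrite size_chain; move: (size (Z 6)) (size (Z 42)) => p q; lia.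
Qed.

Section Tight.
Hypothesis tight : (size (Z 42) + 6 = 7 * size (Z 6))%N.

Lemma tight_chain w : w \in Z 42 -> exists i b, [/\ (i <= 6)%N, b \in Z 6 & w = chain_point i b].
Proof.
have le : (size (Z 42) <= size chain)%N.
  by move: tight Z6_gt0; rewrite size_chain; move: (size (Z 6)) (size (Z 42)) => p q; lia.
move=> wZ; have [_ eZ] := uniq_min_size chain_uniq chain_sub le.
have : w \in chain by rewrite eZ.
rewrite inE => /orP[/eqP ->|]; first by exists 6%N, y.
case/allpairsP => -[i a] [+ aZ ->]; rewrite mem_iota add0n => /= i7.
by exists i, a; split=> //; exact: mem_rem aZ.
Qed.

(* The distance from the line through x and y would double under
   a |-> 2 a - x or 2 a - y, one of which stays in Z 6. *)
Lemma tight_collinear a : a \in Z 6 -> exists2 t, 0 <= t <= 1 & a = x + t *: (y - x).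
Proof.
(* The projection along [y - x] onto the kernel of [l]. If [l y = l x], then [y = x] by injectivity,
   and division by 0 makes [r] the identity, which still kills [y - x]. *)
pose r v := v - (l v / (l y - l x)) *: (y - x).
have rD c u v : r (c *: u + v) = c *: r u + r v.
  by rewrite /r l_lin; apply/rowP => j; rewrite !mxE; ring.
have r0 : r (y - x) = 0.
  rewrite /r lB; have [e|ne] := eqVneq (l y - l x) 0; last by rewrite divff // scale1r subrr.
  have -> : y = x by apply: l_inj => //; apply/eqP; rewrite -subr_eq0 e.
  by rewrite subrr scaler0 subr0.
have [b bZ bmax] := seq_argmax (fun a => `|r (a - x)|) Zn.
have rb : r (b - x) = 0.
  (* This point is a sum of seven points of 6K. Written as a chain point over some [b'], it gives
     [r (b' - x) = 2 *: r (b - x)], against the maximality of [b] unless both vanish. *)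
  have wZ : 2 *: b + 5 *: x \in Z 42.
    have -> : 2 *: b + 5 *: x = b + 1 *: b + 5 *: x by apply/rowP => j; rewrite !mxE; ring.
    have /mem_lattice[//|Kb bi] := bZ; have /mem_lattice[//|Kx xi] := xZ.
    apply/mem_lattice => //; split=> [|j]; last by rewrite !mxE !rpredD ?rpredM ?rpred_nat ?rpred1.
    have := @conv3 _ _ _ 7^-1 7^-1 (5 / 7) Kb Kb Kx.
    rewrite (_ : _ + _ + _ = 42%:R^-1 *: (b + 1 *: b + 5 *: x)).
      by apply; lra.
    by apply/rowP => j; rewrite !mxE; field.
  have [i [b' [i6 b'Z e]]] := tight_chain wZ.
  have e2 : r (b' - x) = 2 *: r (b - x).
    have -> : b' - x = 2 *: (b - x) + ((- i%:R) *: (y - x) + 0).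
      apply/rowP => j; have /rowP/(_ j) := e; rewrite /chain_point !mxE => ej.
      have -> : b' ord0 j = 2 * b ord0 j + 5 * x ord0 j - i%:R * y ord0 j - (6 - i%:R) * x ord0 j.
        by rewrite ej; ring.
      ring.
    have r00 : r 0 = 0 by rewrite /r l0 mul0r scale0r subr0.
    by rewrite !rD r0 r00 scaler0 !addr0.
  have := bmax b' b'Z; rewrite e2 normrZ ger0_norm // => h.
  apply/eqP; rewrite -normr_eq0 eq_le normr_ge0 andbT.
  by have := normr_ge0 (r (b - x)); lra.
move=> aZ; have ra : r (a - x) = 0.
  apply/eqP; rewrite -normr_eq0 eq_le normr_ge0 andbT.
  by apply: le_trans (bmax a aZ) _; rewrite rb normr0.
exists ((l a - l x) / (l y - l x)).
  have lyx : 0 <= l y - l x by rewrite subr_ge0 xmin.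
  rewrite divr_ge0 ?subr_ge0 ?xmin //=.
  have [->|ne] := eqVneq (l y - l x) 0; first by rewrite invr0 mulr0.
  by rewrite ler_pdivrMr ?mul1r ?lerD2r ?ymax // lt_neqAle eq_sym ne.
by apply/eqP; rewrite addrC -subr_eq -lB -subr_eq0; apply/eqP.
Qed.

(** Write 6z = b + iy + (6-i)x as a chain point. For i = 0 or i = 6, the point b/6 of K would be the
    integral vector z - x or z - y, which is excluded. For 1 <= i <= 5 and b = x + t(y - x), solving
    gives 6(x + y - z) = (i-1+t)x + (6-i-t)y. Both coefficients are nonnegative with sum 5, so (x +
    y - z)/5 lies between x/6 and y/6. *)
Lemma tight_reflect z : Z 1 = fset0 -> z \in Z 7 -> x + y - z \in Z 5.
Proof.
move=> Z1 /mem_lattice[//|Kz zi].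
have /mem_lattice[//|Kx xi] := xZ; have /mem_lattice[//|Ky yi] := yZ.
have no v : K v -> (forall i, v ord0 i \is a Num.int) -> False.
  move=> Kv vi; suff : v \in Z 1 by rewrite Z1.
  by apply/mem_lattice => //; rewrite invr1 scale1r.
have wZ : 6 *: z \in Z 42.
  apply/mem_lattice => //; split=> [|j]; last by rewrite mxE rpredM ?rpred_nat.
  rewrite (_ : 42%:R^-1 *: _ = 7%:R^-1 *: z) //.
  by apply/rowP => j; rewrite !mxE; field.
have [i [b [i6 bZ e]]] := tight_chain wZ.
have /mem_lattice[//|Kb bi] := bZ.
have i_gt0 : (0 < i)%N.
  rewrite lt0n; apply/eqP => i0; apply: (no (z - x)) => [|j]; last by rewrite !mxE rpredB.
  rewrite (_ : z - x = 6%:R^-1 *: b) //; apply/rowP => j.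
  have /rowP/(_ j) := e; rewrite /chain_point i0 !mxE => ej.
  have -> : b ord0 j = 6 * z ord0 j - 6 * x ord0 j by rewrite ej; ring.
  by field.
have i_lt6 : (i < 6)%N.
  rewrite ltn_neqAle i6 andbT; apply/eqP => i0; apply: (no (z - y)) => [|j]; last by rewrite !mxE rpredB.
  rewrite (_ : z - y = 6%:R^-1 *: b) //; apply/rowP => j.
  have /rowP/(_ j) := e; rewrite /chain_point i0 !mxE => ej.
  have -> : b ord0 j = 6 * z ord0 j - 6 * y ord0 j by rewrite ej; ring.
  by field.
have [t /andP[t0 t1] bE] := tight_collinear bZ.
apply/mem_lattice => //; split=> [|j]; last by rewrite !mxE rpredB ?rpredD.
have i1 : 1 <= i%:R :> R by rewrite ler1n.
have i5 : i%:R <= 5%:R :> R by rewrite ler_nat.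
have := @conv2 _ _ ((i%:R - 1 + t) / 5) Kx Ky.
rewrite (_ : _ + _ = 5%:R^-1 *: (x + y - z)).
  by apply; lra.
apply/rowP => j; have /rowP/(_ j) := e; rewrite /chain_point bE !mxE => ej.
have -> : z ord0 j = (x ord0 j + t * (y ord0 j - x ord0 j) + i%:R * y ord0 j + (6 - i%:R) * x ord0 j) / 6.
  by rewrite -ej; field.
by field.
Qed.

End Tight.
End Chain.

Lemma lattice_count_bound : (7 * lattice_count K 6 <= lattice_count K 42 + 6 * lattice_count K 0)%N.
Proof.
rewrite lattice_count0 !lattice_countE; have [->|Zn] := eqVneq (Z 6 : seq _) [::]; first by [].
have [l [l_lin l_inj]] := separating_functional (Z 6 : seq _).
have [x xZ xmin] := seq_argmax (fun v => - l v) Zn.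
have [y yZ ymax] := seq_argmax l Zn.
have xmin' : {in Z 6, forall v, l x <= l v} by move=> v /xmin; rewrite lerN2.
have -> : `[< K !=set0 >] = true.
  by have /mem_lattice[//|Kx _] := xZ; apply/asboolP; exists (6%:R^-1 *: x).
by rewrite muln1; exact: chain_bound l_lin l_inj xZ yZ xmin' ymax.
Qed.

Lemma lattice_count_tight : lattice_count K 1 = 0%N ->
  (7 * lattice_count K 6 = lattice_count K 42 + 6 * lattice_count K 0)%N ->
  (lattice_count K 7 <= lattice_count K 5)%N.
Proof.
rewrite lattice_count0 !lattice_countE => N1; case: asboolP => [K0|nK0] tight; last first.
  suff -> : (Z 7 : seq _) = [::] by [].
  case E : (Z 7 : seq _) => [//|v s]; case: nK0.
  have : v \in Z 7 by rewrite -[_ \in Z 7]/(v \in (Z 7 : seq _)) E mem_head.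
  by move=> /mem_lattice[//|Kv _]; exists (7%:R^-1 *: v).
have Z1 : Z 1 = fset0 by apply: cardfs0_eq.
have Zn : (Z 6 : seq _) != [::] by apply: contra_eqN tight => /eqP ->; rewrite muln0 eq_sym addn_eq0 andbF.
have [l [l_lin l_inj]] := separating_functional (Z 6 : seq _).
have [x xZ xmin] := seq_argmax (fun v => - l v) Zn.
have [y yZ ymax] := seq_argmax l Zn.
have xmin' : {in Z 6, forall v, l x <= l v} by move=> v /xmin; rewrite lerN2.
have tight' : (size (Z 42) + 6 = 7 * size (Z 6))%N by rewrite tight muln1.
rewrite -(size_map (fun z => x + y - z)); apply: uniq_leq_size.
  by rewrite map_inj_uniq ?fset_uniq // => u v /addrI/oppr_inj.
by move=> _ /mapP[z zZ ->]; exact: (tight_reflect l_lin l_inj xZ yZ xmin' ymax tight' Z1 zZ).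
Qed.

End ConvexBody.

Section Obstruction.
Local Open Scope ring_scope.

Theorem lattice_count_combination_obstruction (R : realType) (f : nat -> nat) :
  lattice_count_combination R f -> f 1%N = 0%N -> (f 42 + 6 * f 0 = 7 * f 6)%N ->
  (f 7 <= f 5)%N.
Proof.
move=> [N [c [m [K [c0 cK vK fE]]]]] f1 tight.
(* The defect of [f] is a sum of nonnegative defects with positive weights; being 0, it vanishes for
   each body. The same argument applies to the count at 1. *)
have tight_i i : (7 * lattice_count (K i) 6 = lattice_count (K i) 42 + 6 * lattice_count (K i) 0)%N.
  have : \sum_(i < N) c i * ((lattice_count (K i) 42 + 6 * lattice_count (K i) 0)%:R -
      (7 * lattice_count (K i) 6)%:R) = 0.
    transitivity ((f 42)%:R + 6%:R * (f 0)%:R - 7%:R * (f 6)%:R : R).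
      rewrite !fE !mulr_sumr -big_split -sumrB /=.
      by apply: eq_bigr => j _; rewrite natrD !natrM; ring.
    by rewrite -!natrM -natrD tight subrr.
  move/eqP; rewrite psumr_eq0 => [/allP/(_ i (mem_index_enum i))|j _]; last first.
    by rewrite mulr_ge0 ?(ltW (c0 j)) // subr_ge0 ler_nat lattice_count_bound.
  by rewrite /= mulf_eq0 gt_eqF //= subr_eq0 eqr_nat => /eqP.
have N1 i : lattice_count (K i) 1 = 0%N.
  have /esym/eqP := fE 1%N; rewrite f1 psumr_eq0 => [/allP/(_ i (mem_index_enum i))|j _]; last first.
    by rewrite mulr_ge0 ?(ltW (c0 j)).
  by rewrite /= mulf_eq0 gt_eqF //= pnatr_eq0 => /eqP.
rewrite -(ler_nat R) !fE; apply: ler_sum => i _; rewrite ler_pM2l // ler_nat.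
exact: (lattice_count_tight (cK i) (vK i)).
Qed.

End Obstruction.

(** * Numerical values *)

Lemma nat_of_bin_add a b : nat_of_bin (BinNat.N.add a b) = nat_of_bin a + nat_of_bin b.
Proof. by case: a => [|a]; case: b => [|b] //=; rewrite ?addn0 // nat_of_add_pos. Qed.

Section BoxTable.
Variable J : nat.

(* Truncations at degree J of the generating functions in j of
   size (box_seqs d k j), listed for k = 0, 1, 2, ... *)
Definition box_row0 K : seq (seq BinNums.N) := nseq K.+1 (BinNums.Npos BinNums.xH :: nseq J BinNums.N0).

Definition poly_add (p q : seq BinNums.N) := [seq BinNat.N.add x.1 x.2 | x <- zip p q].

Definition poly_shift k (p : seq BinNums.N) := take J.+1 (nseq k BinNums.N0 ++ p).

(** The recursion for Gaussian binomials by largest part, G(d+1, k) = G(d+1, k-1) + q^k G(d, k);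
    [acc] holds G(d+1, k-1), and [rows] lists G(d, k), G(d, k+1), ... *)
Fixpoint next_box_row (acc : seq BinNums.N) k (rows : seq (seq BinNums.N)) :=
  if rows is p :: rows' then
    let a := poly_add acc (poly_shift k p) in a :: next_box_row a k.+1 rows'
  else [::].

Definition box_table d K := iter d (next_box_row (nseq J.+1 BinNums.N0) 0) (box_row0 K).

Definition represents (p : seq BinNums.N) (f : nat -> nat) :=
  size p = J.+1 /\ forall j, j <= J -> nat_of_bin (nth BinNums.N0 p j) = f j.

Lemma represents_step acc p f g k : represents acc f -> represents p g ->
  represents (poly_add acc (poly_shift k p)) (fun j => f j + if k <= j then g (j - k) else 0).
Proof.
move=> [sa ra] [sp rp].
have ss : size (poly_shift k p) = J.+1.
  by rewrite size_takel // size_cat size_nseq sp leq_addl.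
split; first by rewrite size_map size_zip sa ss minnn.
move=> j jJ; rewrite (nth_map (BinNums.N0, BinNums.N0)) ?size_zip ?sa ?ss ?minnn // nth_zip ?sa ?ss //=.
rewrite nat_of_bin_add ra // nth_take // nth_cat size_nseq; congr (_ + _).
case: leqP => kj; first by rewrite rp // (leq_trans (leq_subr _ _)).
by rewrite nth_nseq kj.
Qed.

Lemma next_box_rowP d K acc k rows : size rows = K ->
  (forall i, i < K -> represents (nth [::] rows i) (fun j => size (box_seqs d (k + i) j))) ->
  represents acc (fun j => \sum_(x < k) if x <= j then size (box_seqs d x (j - x)) else 0) ->
  size (next_box_row acc k rows) = K /\
  forall i, i < K -> represents (nth [::] (next_box_row acc k rows) i)
    (fun j => size (box_seqs d.+1 (k + i) j)).
Proof.
elim: rows K acc k => [|p rows IHr] K acc k /= <- // rp ra.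
set a := poly_add _ _.
have ra' : represents a (fun j => \sum_(x < k.+1) if x <= j then size (box_seqs d x (j - x)) else 0).
  have := represents_step k ra (rp 0 isT); rewrite /= addn0 => -[sz h]; split=> // j jJ.
  by rewrite h // big_ord_recr.
have [|sz h] := IHr _ a k.+1 erefl _ ra'; first by move=> i; rewrite addSnnS; exact: (rp i.+1).
rewrite sz; split=> // -[_|i /h]; last by rewrite addSnnS.
by case: ra' => s' h'; split=> // j jJ; rewrite h' // addn0 size_box_seqsS.
Qed.

Lemma box_tableP d K k j : k <= K -> j <= J ->
  size (box_seqs d k j) = nat_of_bin (nth BinNums.N0 (nth [::] (box_table d K) k) j).
Proof.
move=> kK jJ; suff [_ /(_ k)] : size (box_table d K) = K.+1 /\
    forall i, i < K.+1 -> represents (nth [::] (box_table d K) i) (fun j => size (box_seqs d i j)).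
  by rewrite ltnS => /(_ kK)[_ ->].
elim: d => [|d [sz h]].
  rewrite size_nseq; split=> // i iK; rewrite nth_nseq iK; split=> [|[|n] nJ] //=.
    by rewrite size_nseq.
  by rewrite nth_nseq; case: ifP.
apply: (next_box_rowP (k := 0) sz h); split; first by rewrite size_nseq.
by move=> n nJ; rewrite big_ord0 nth_nseq; case: ifP.
Qed.

End BoxTable.

Definition two_row_multiplicity d k j :=
  size (box_seqs d k j) - (if j is j'.+1 then size (box_seqs d k j') else 0).

Definition box_multiplicity d k j :=
  let row := nth [::] (box_table j d k) k in
  nat_of_bin (nth BinNums.N0 row j) - (if j is j'.+1 then nat_of_bin (nth BinNums.N0 row j') else 0).

Lemma two_row_multiplicityE d k j : two_row_multiplicity d k j = box_multiplicity d k j.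
Proof.
rewrite /two_row_multiplicity /box_multiplicity (@box_tableP j d k k j) //.
by case: j => // j; rewrite (@box_tableP j.+1 d k k j).
Qed.

Lemma scale_partition_75 s N : N = 12 * s -> scale_partition s [:: 7; 5] = two_row N (5 * s).
Proof. by move=> ->; rewrite /scale_partition /two_row /= -mulnBl !(mulnC s). Qed.

Lemma plethysm_coeff_75 (R : realType) d k s : d * k = 12 * s ->
  plethysm_coeff R d k (scale_partition s [:: 7; 5]) = box_multiplicity d k (5 * s).
Proof.
move=> dk; rewrite (scale_partition_75 dk) plethysm_coeff_two_row -?two_row_multiplicityE //.
by rewrite dk; lia.
Qed.

(** The values satisfy 15 + 6 * 1 = 7 * 3 and vanish at 1, while those at 7 and 5 are 2 > 1. Letting
    both [d] and [k] depend on [s] covers the two halves of the theorem at once. *)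
Lemma no_combination_75 (R : realType) (d k : nat -> nat) :
  (forall s, d s * k s = 12 * s) ->
  [seq box_multiplicity (d s) (k s) (5 * s) | s <- [:: 0; 1; 5; 6; 7; 42]] = [:: 1; 0; 1; 3; 2; 15] ->
  ~ lattice_count_combination R (fun s => plethysm_coeff R (d s) (k s) (scale_partition s [:: 7; 5])).
Proof.
move=> dk [v0 v1 v5 v6 v7 v42] /lattice_count_combination_obstruction.
by rewrite !plethysm_coeff_75 // v0 v1 v5 v6 v7 v42 => /(_ erefl erefl).
Qed.

Theorem corollary10 (R : realType) :
  (exists (d k : nat) (la : seq nat),
    [/\ (0 < d)%N, (0 < k)%N, is_partition_of (d * k) la
      & ~ lattice_count_combination R
            (fun s => plethysm_coeff R d (s * k) (scale_partition s la))]) /\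
  (exists (d k : nat) (la : seq nat),
    [/\ (0 < d)%N, (0 < k)%N, is_partition_of (d * k) la
      & ~ lattice_count_combination R
            (fun s => plethysm_coeff R (s * d) k (scale_partition s la))]).
Proof.
split.
  exists 3, 4, [:: 7; 5]; split=> //; apply: (@no_combination_75 R (fun=> 3) (fun s => s * 4)).
    by move=> s; lia.
  by vm_compute.
exists 4, 3, [:: 7; 5]; split=> //; apply: (@no_combination_75 R (fun s => s * 4) (fun=> 3)).
  by move=> s; lia.
by vm_compute.
Qed.
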